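(* Let $M=M[P,Q]$ be a lattice path matroid. Suppose that for every connected component $X$ of $M$, every pair $(A,B)$ consisting of an initial connected flat $A$ and a final connected flat $B$ of the restriction $M|X$ is a modular pair. Then $M$ is configuration unique.
   Context: A lattice path is a word $p_1\cdots p_n$ in the letters $N$ (unit step north) and $E$ (unit step east), read as a path from $(0,0)$. For lattice paths $P=p_1\cdots p_n$, $Q=q_1\cdots q_n$ from $(0,0)$ to $(m,r)$ with $P$ never above $Q$, let $u_1<\cdots<u_r$ be the positions of the north steps of $P$ and $l_1<\cdots<l_r$ those of $Q$, and $N_i=\{l_i,\ldots,u_i\}$; $M[P,Q]$ is the transversal matroid on $[n]$ whose independent sets are the partial transversals of $(N_1,\ldots,N_r)$. If the lattice points common to $P$ and $Q$ are $c_0=(0,0),c_1,\ldots,c_k=(m,r)$ in order along the paths, then for each $j$ the portions $P',Q'$ of $P,Q$ from $c_{j-1}$ to $c_j$ (translated to start at $(0,0)$) determine a connected lattice path matroid $M[P',Q']$ on $[n']$ ($n'$ the length of $P'$), which is isomorphic, via the shift $t\mapsto t+c$ where $c$ is the number of steps before $c_{j-1}$, to the restriction of $M[P,Q]$ to the interval $[c+1,c+n']$; these intervals are exactly the connected components of $M[P,Q]$. For a connected $M[P',Q']$ with $P'=p'_1\cdots p'_{n'}$, $Q'=q'_1\cdots q'_{n'}$, an initial connected flat is an interval $[a]$ with $q'_a=E$, $q'_{a+1}=N$, and a final connected flat is an interval $[b,n']$ with $p'_{b-1}=N$, $p'_b=E$; initial/final connected flats of the component restriction are the images of these under the shift. A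 pair $(X,Y)$ is modular if $r(X)+r(Y)=r(X\cup Y)+r(X\cap Y)$. Cyclic flats are flats that are unions of circuits, forming a lattice $\mathcal{Z}(M)$. Matroids $M,N$ have the same configuration if $|E(M)|=|E(N)|$ and there is a lattice isomorphism $\Phi:\mathcal{Z}(M)\to\mathcal{Z}(N)$ preserving sizes and ranks; $M$ is configuration unique if every matroid with the same configuration as $M$ is isomorphic to $M$. *)

(* Defs.v *)
From HB Require Import structures.
From mathcomp Require Import all_boot.
Set Implicit Arguments.
Unset Strict Implicit.
Unset Printing Implicit Defensive.

(* The ground set of a matroid is a whole finite type. *)
Record matroid (T : finType) := Matroid {
  indep : {set T} -> bool;
  indep0 : indep set0;
  indep_sub : forall I J : {set T}, J \subset I -> indep I -> indep J;
  indep_aug : forall I J : {set T}, indep I -> indep J -> #|I| < #|J| ->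
    exists2 x, x \in J :\: I & indep (x |: I)
}.

Definition rank (T : finType) (M : matroid T) (X : {set T}) : nat :=
  \max_(I : {set T} | indep M I && (I \subset X)) #|I|.

Definition flat (T : finType) (M : matroid T) (F : {set T}) : bool :=
  [forall x, (x \notin F) ==> (rank M F < rank M (x |: F))].

Definition circuit (T : finType) (M : matroid T) (C : {set T}) : bool :=
  minset (fun D : {set T} => ~~ indep M D) C.

Definition cyclic (T : finType) (M : matroid T) (X : {set T}) : bool :=
  X == \bigcup_(C : {set T} | circuit M C && (C \subset X)) C.

Definition cyclic_flats (T : finType) (M : matroid T) : {set {set T}} :=
  [set X | cyclic M X && flat M X].

Definition modular_pair (T : finType) (M : matroid T) (X Y : {set T}) : Prop :=
  rank M X + rank M Y = rank M (X :|: Y) + rank M (X :&: Y).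

(* The classes of the equivalence relation "x = y or some circuit contains
   both x and y". *)
Definition connected_component (T : finType) (M : matroid T) (X : {set T}) :
    Prop :=
  exists x, X = [set y | (y == x) ||
    [exists C : {set T}, [&& circuit M C, x \in C & y \in C]]].

Definition isomorphic (T U : finType) (M : matroid T) (N : matroid U) : Prop :=
  exists2 f : T -> U, bijective f &
    forall X : {set T}, indep N (f @: X) = indep M X.

(* The cyclic flats form a lattice under inclusion, so a lattice isomorphism
   is a bijection that preserves and reflects inclusion. *)
Definition same_configuration (T U : finType) (M : matroid T) (N : matroid U) :
    Prop :=
  #|T| = #|U| /\
  exists Phi : {set T} -> {set U},
    [/\ Phi @: cyclic_flats M = cyclic_flats N,
        {in cyclic_flats M &, injective Phi},
        {in cyclic_flats M &, {mono Phi : X Y / X \subset Y}},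
        {in cyclic_flats M, forall X : {set T}, #|Phi X| = #|X|} &
        {in cyclic_flats M, forall X : {set T}, rank N (Phi X) = rank M X}].

Definition configuration_unique (T : finType) (M : matroid T) : Prop :=
  forall (U : finType) (N : matroid U),
    same_configuration M N -> isomorphic M N.

Definition restr_indep (T : finType) (M : matroid T) (X : {set T})
    (I : {set {x : T | x \in X}}) : bool :=
  indep M (val @: I).

Lemma restr_indep0 (T : finType) (M : matroid T) (X : {set T}) :
  restr_indep M (X := X) set0.
Proof. by rewrite /restr_indep imset0 indep0. Qed.

Lemma restr_indep_sub (T : finType) (M : matroid T) (X : {set T})
    (I J : {set {x : T | x \in X}}) :
  J \subset I -> restr_indep M I -> restr_indep M J.
Proof. by move=> sJI; apply: indep_sub; apply: imsetS. Qed.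

Lemma restr_indep_aug (T : finType) (M : matroid T) (X : {set T})
    (I J : {set {x : T | x \in X}}) :
  restr_indep M I -> restr_indep M J -> #|I| < #|J| ->
  exists2 x, x \in J :\: I & restr_indep M (x |: I).
Proof.
move=> iI iJ ltIJ.
have [|y] := indep_aug iI iJ; first by rewrite !card_imset //; exact: val_inj.
rewrite inE => /andP[yI /imsetP[x xJ def_y]] iy; exists x.
  rewrite inE xJ andbT; apply: contra yI => xI.
  by rewrite def_y; apply: imset_f.
by rewrite /restr_indep imsetU1 -def_y.
Qed.

Definition restr (T : finType) (M : matroid T) (X : {set T}) :
    matroid {x : T | x \in X} :=
  Matroid (restr_indep0 M X) (@restr_indep_sub T M X) (@restr_indep_aug T M X).

(* X is a partial transversal of the family A: the elements of X are matched
   injectively with indices j such that x \in A j.  The option type only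
   serves families with an empty index type; elements outside X are
   unconstrained. *)
Definition matches (T J : finType) (A : J -> {set T}) (X : {set T})
    (f : {ffun T -> option J}) : bool :=
  dinjectiveb f (mem X) &&
  [forall x in X, if f x is Some j then x \in A j else false].

Definition partial_transversal (T J : finType) (A : J -> {set T})
    (X : {set T}) : bool :=
  [exists f : {ffun T -> option J}, matches A X f].

Lemma matchesP (T J : finType) (A : J -> {set T}) (X : {set T})
    (f : {ffun T -> option J}) :
  reflect ({in X &, injective f} /\
           {in X, forall x, exists2 j, f x = Some j & x \in A j})
          (matches A X f).
Proof.
apply: (iffP andP) => [[/dinjectiveP injf /forall_inP fA] | [injf fA]]; split.
- exact: injf.
- by move=> x /fA; case: (f x) => // j xAj; exists j.
- exact/dinjectiveP.
- by apply/forall_inP => x /fA[j -> ->].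
Qed.

Lemma partial_transversal0 (T J : finType) (A : J -> {set T}) :
  partial_transversal A set0.
Proof.
apply/existsP; exists [ffun _ => None]; apply/matchesP.
by split=> [x y | x]; rewrite inE.
Qed.

Lemma partial_transversal_sub (T J : finType) (A : J -> {set T})
    (X Y : {set T}) :
  Y \subset X -> partial_transversal A X -> partial_transversal A Y.
Proof.
move=> /subsetP sYX /existsP[f /matchesP[injf fA]].
apply/existsP; exists f; apply/matchesP; split=> [x y Yx Yy | x /sYX/fA //].
by apply: injf; apply: sYX.
Qed.

Lemma partial_transversal_aug (T J : finType) (A : J -> {set T})
    (X Y : {set T}) :
  partial_transversal A X -> partial_transversal A Y -> #|X| < #|Y| ->
  exists2 x, x \in Y :\: X & partial_transversal A (x |: X).
Proof.
move=> /existsP[f mf] /existsP[g /matchesP[injg gA]] ltXY.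
have [k] := ubnP #|[set x in X :&: Y | f x != g x]|.
elim: k f mf => // k IHk f /matchesP[injf fA] lek.
have /subsetPn[j /imsetP[y Yy def_j] jf]: ~~ (g @: Y \subset f @: X).
  apply: contraL ltXY => /subset_leq_card.
  by rewrite -leqNgt !card_in_imset.
pose h := [ffun x => if x == y then g y else f x].
have hy: h y = g y by rewrite ffunE eqxx.
have hN x : x != y -> h x = f x by rewrite ffunE => /negPf->.
have f_gy x : x \in X -> f x != g y.
  by move=> Xx; apply: contraNneq jf => e; rewrite def_j -e; apply: imset_f.
have mh : matches A (y |: X) h.
  apply/matchesP; split=> [x z | x].
    rewrite !inE; case: (eqVneq x y) => [-> _|xy /= Xx].
      case: (eqVneq z y) => [-> //|zy /= Xz].
      by rewrite hy hN // => e; have:= f_gy z Xz; rewrite -e eqxx.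
    case: (eqVneq z y) => [-> _|zy /= Xz].
      by rewrite hy hN // => e; have:= f_gy x Xx; rewrite e eqxx.
    by rewrite !hN //; apply: injf.
  rewrite !inE; case: (eqVneq x y) => [-> _|xy /= Xx].
    by rewrite hy; apply: gA.
  by rewrite hN //; apply: fA.
case: (boolP (y \in X)) => [Xy | nXy]; last first.
  by exists y; [rewrite inE nXy | apply/existsP; exists h].
apply: (IHk h); first by rewrite (setUidPr _) ?sub1set in mh.
apply: leq_trans (_ : _ < #|[set x in X :&: Y | f x != g x]|) _; last by [].
apply: proper_card; apply/properP; split.
  apply/subsetP => x; rewrite !inE => /andP[-> /=].
  by case: (eqVneq x y) => [->|xy]; rewrite ?hy ?eqxx // hN.
exists y; first by rewrite !inE Xy Yy f_gy.
by rewrite !inE hy eqxx andbF.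
Qed.

Definition transversal_matroid (T J : finType) (A : J -> {set T}) :
    matroid T :=
  Matroid (partial_transversal0 A) (@partial_transversal_sub T J A)
          (@partial_transversal_aug T J A).

Inductive step := North | East.

Definition bool_of_step (s : step) : bool := if s is North then true else false.
Definition step_of_bool (b : bool) : step := if b then North else East.
Lemma bool_of_stepK : cancel bool_of_step step_of_bool.
Proof. by case. Qed.

HB.instance Definition _ := Equality.copy step (can_type bool_of_stepK).

(* Positions in a word are numbered from 1; there is no letter at position 0
   or beyond the end of the word. *)
Definition letter (s : seq step) (i : nat) : option step :=
  if i is j.+1 then onth s j else None.

Definition endpoint (s : seq step) : nat * nat :=
  (count_mem East s, count_mem North s).

(* After k steps both paths are on the antidiagonal x + y = k, where
   "not above" means "not of larger height". *)
Definition never_above (P Q : seq step) : Prop :=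
  forall k, (endpoint (take k P)).2 <= (endpoint (take k Q)).2.

Definition north_positions (s : seq step) : seq nat :=
  [seq i <- iota 1 (size s) | letter s i == Some North].

(* x : 'I_n stands for the element x.+1 of [n] = {1, ..., n}. *)
Definition interval (n a b : nat) : {set 'I_n} := [set x : 'I_n | a <= x.+1 <= b].

Definition path_sets (n : nat) (P Q : seq step)
    (i : 'I_(count_mem North P)) : {set 'I_n} :=
  interval n (nth 0 (north_positions Q) i) (nth 0 (north_positions P) i).

Definition lattice_path_matroid (n : nat) (P Q : n.-tuple step) : matroid 'I_n :=
  transversal_matroid (@path_sets n P Q).

(* A lattice point common to P and Q is reached by both after the same number
   k of steps. *)
Definition common_point (P Q : seq step) (k : nat) : bool :=
  (k <= size P) && (endpoint (take k P) == endpoint (take k Q)).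

Definition consecutive_common_points (P Q : seq step) (c d : nat) : Prop :=
  [/\ c < d, common_point P Q c, common_point P Q d &
      forall k, c < k < d -> ~~ common_point P Q k].

Definition portion (s : seq step) (c d : nat) : seq step :=
  take (d - c) (drop c s).

Definition initial_connected_flat (n : nat) (P Q : n.-tuple step)
    (X : {set 'I_n}) (A : {set {x : 'I_n | x \in X}}) : Prop :=
  exists c d a : nat,
    [/\ consecutive_common_points P Q c d,
        X = interval n c.+1 d,
        letter (portion Q c d) a = Some East,
        letter (portion Q c d) a.+1 = Some North &
        val @: A = interval n c.+1 (c + a)].

Definition final_connected_flat (n : nat) (P Q : n.-tuple step)
    (X : {set 'I_n}) (B : {set {x : 'I_n | x \in X}}) : Prop :=
  exists c d b : nat,
    [/\ consecutive_common_points P Q c d,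
        X = interval n c.+1 d,
        letter (portion P c d) b.-1 = Some North,
        letter (portion P c d) b = Some East &
        val @: B = interval n (c + b) d].

(* Main.v *)
Require Import Defs.
From mathcomp Require Import all_boot zify.

(** A matroid is determined by its cyclic flats and their ranks, so an
    isomorphism onto a matroid N with the same configuration is a bijection of
    ground sets that carries every cyclic flat F of M to Phi F.

    Write lo and hi for the height functions of P and Q.  A set X is independent
    in M[P,Q] iff |X cap (s,t]| + lo s <= hi t for all s <= t.  Up to loops and
    coloops, the prefixes [1,a] ending at an EN corner of Q form a chain of
    cyclic flats, and so do the suffixes (p,n] starting at an NE corner of P.
    Modularity inside the components says that no EN corner of Q lies strictly
    north-west of an NE corner of P; this makes every prefix modular with every
    suffix, and modularity forces |Phi A cap Phi B| = |A cap B|.  Since both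
    families are chains, a bijection f with f(A) = Phi A and f(B) = Phi B
    exists.  Finally every cyclic flat is an intersection of cyclic flats of the
    form A cup B: an element outside F is cut off by corners found at the ends
    of intervals that are tight for a basis of F. *)

Set Implicit Arguments.
Unset Strict Implicit.
Unset Printing Implicit Defensive.

(** * Rank, closure and cyclic flats *)

(** The obstacle is that [N] is arbitrary and a configuration records a lattice whose meets are not
    intersections. The join of two cyclic flats is the closure of their union, so ranks of unions
    are controlled; an intersection of cyclic flats need not be cyclic, and its size is not
    recorded. For a modular pair, submodularity in [N] bounds the rank of [Phi A :&: Phi B] by that
    of [A :&: B], and a comparison of nullities then bounds the size. Two chains suffice because an
    intersection inside a chain is again a member: every intersection of members reduces to at most
    one [A] and one [B], and matching the sizes of these is all that a bijection needs. The corner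
    condition is the inequality [hi a <= lo p + (a - p)]. For corners inside one component it comes
    out of crude rank estimates; for corners in different components it holds because a common point
    of the paths lies between them. A prefix may contain coloops and miss loops, so it is replaced
    by its [core], which drops the former and adds the latter. *)

Section Rank.

Variables (T : finType) (M : matroid T).
Implicit Types (I J X Y Z : {set T}) (x y : T).

Lemma rank_ge I X : indep M I -> I \subset X -> #|I| <= rank M X.
Proof.
by move=> iI sIX; rewrite /rank (bigmax_sup I) ?iI.
Qed.

Lemma rank_basis X : exists I, [/\ indep M I, I \subset X & #|I| = rank M X].
Proof.
have P0 : indep M set0 && (set0 \subset X) by rewrite indep0 sub0set.
have ne : 0 < #|[pred I : {set T} | indep M I && (I \subset X)]|.
  by apply/card_gt0P; exists set0; rewrite inE.
have [I /andP[iI sIX] eI] := eq_bigmax_cond (fun I : {set T} => #|I|) ne.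
by exists I; split=> //; rewrite /rank eI.
Qed.

Lemma rank_le_card X : rank M X <= #|X|.
Proof. by have [I [_ sIX <-]] := rank_basis X; apply: subset_leq_card. Qed.

Lemma rank_le X m :
  (forall I, indep M I -> I \subset X -> #|I| <= m) -> rank M X <= m.
Proof. by move=> h; have [I [iI sIX <-]] := rank_basis X; apply: h. Qed.

Lemma rankS X Y : X \subset Y -> rank M X <= rank M Y.
Proof.
move=> sXY; apply: rank_le => I iI sIX.
by apply: rank_ge => //; apply: subset_trans sXY.
Qed.

Lemma rank_indep I : indep M I -> rank M I = #|I|.
Proof. by move=> iI; apply/eqP; rewrite eqn_leq rank_le_card rank_ge. Qed.

Lemma indep_rank X : #|X| <= rank M X -> indep M X.
Proof.
have [I [iI sIX eI]] := rank_basis X; rewrite -eI => leXI.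
by suff <- : I = X by []; apply/eqP; rewrite eqEcard sIX.
Qed.

Lemma rank0 : rank M set0 = 0.
Proof. by rewrite rank_indep ?cards0 ?indep0. Qed.

Lemma basis_extension I X :
  indep M I -> I \subset X ->
  exists B, [/\ indep M B, I \subset B, B \subset X & #|B| = rank M X].
Proof.
have [k] := ubnP (rank M X - #|I|); elim: k I => // k IHk I ltk iI sIX.
have [leXI|ltIX] := leqP (rank M X) #|I|.
  by exists I; split=> //; apply/eqP; rewrite eqn_leq leXI rank_ge.
have [J [iJ sJX eJ]] := rank_basis X; rewrite -eJ in ltIX.
have [x] := indep_aug iI iJ ltIX; rewrite inE => /andP[xI xJ] ixI.
have [|//||B [iB sIB sBX eB]] := IHk (x |: I).
- by rewrite cardsU1 xI /=; lia.
- by rewrite subUset sub1set (subsetP sJX).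
- by exists B; split=> //; apply: subset_trans sIB; apply: subsetUr.
Qed.

(** A basis of [X :&: Y], extended to a basis of [X :|: Y], leaves independent traces on [X] and on
    [Y]; counting the traces gives the inequality. *)
Lemma rank_submod X Y :
  rank M (X :|: Y) + rank M (X :&: Y) <= rank M X + rank M Y.
Proof.
have [I [iI sI eI]] := rank_basis (X :&: Y).
have sIU : I \subset X :|: Y.
  by apply: subset_trans sI _; rewrite subIset ?subsetUl.
have [B [iB sIB sB eB]] := basis_extension iI sIU.
have iBX: indep M (B :&: X) by apply: indep_sub iB; apply: subsetIl.
have iBY: indep M (B :&: Y) by apply: indep_sub iB; apply: subsetIl.
have := rank_ge iBX (subsetIr _ _); have := rank_ge iBY (subsetIr _ _).
have := cardsUI (B :&: X) (B :&: Y); rewrite -setIUr (setIidPl sB) -setIIr.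
have /subset_leq_card : I \subset B :&: (X :&: Y) by rewrite subsetI sIB.
by rewrite -eI -eB; lia.
Qed.

Lemma rankU1 x X : rank M (x |: X) <= (rank M X).+1.
Proof.
have := rank_submod [set x] X; have := rank_le_card [set x].
by rewrite cards1; lia.
Qed.

Lemma rankU X Y : rank M (X :|: Y) <= rank M X + #|Y|.
Proof. by have := rank_submod X Y; have := rank_le_card Y; lia. Qed.

Definition closure X : {set T} := [set x | rank M (x |: X) == rank M X].

Lemma mem_closure x X : (x \in closure X) = (rank M (x |: X) == rank M X).
Proof. by rewrite inE. Qed.

Lemma sub_closure X : X \subset closure X.
Proof.
by apply/subsetP => x xX; rewrite mem_closure (setUidPr _) ?sub1set.
Qed.

Lemma closureS X Y : X \subset Y -> closure X \subset closure Y.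
Proof.
move=> sXY; apply/subsetP => x; rewrite !mem_closure => /eqP e.
rewrite eqn_leq [X in _ && X]rankS ?subsetUr // andbT.
have := rank_submod (x |: X) Y.
have -> : (x |: X) :|: Y = x |: Y by rewrite -setUA (setUidPr sXY).
have : rank M X <= rank M ((x |: X) :&: Y).
  by apply: rankS; rewrite subsetI subsetUr sXY.
by lia.
Qed.

Lemma rankU_closure X Y : Y \subset closure X -> rank M (X :|: Y) = rank M X.
Proof.
have [k] := ubnP #|Y|; elim: k Y => // k IHk Y ltk sY.
have [->|[y yY]] := set_0Vmem Y; first by rewrite setU0.
rewrite -(setD1K yY) setUCA.
have sY' : Y :\ y \subset closure X by apply: subset_trans sY; apply: subsetDl.
have e : rank M (X :|: Y :\ y) = rank M X.
  by apply: IHk => //; move: ltk; rewrite (cardsD1 y Y) yY; lia.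
rewrite -[RHS]e; apply/eqP; rewrite -mem_closure.
by apply: (subsetP (closureS (subsetUl X (Y :\ y)))); apply: (subsetP sY).
Qed.

Lemma rank_closure X : rank M (closure X) = rank M X.
Proof.
by rewrite -{1}(setUidPr (sub_closure X)) rankU_closure.
Qed.

Lemma closureK X : closure (closure X) = closure X.
Proof.
apply/eqP; rewrite eqEsubset sub_closure andbT; apply/subsetP => x.
rewrite !mem_closure rank_closure => /eqP e.
rewrite eqn_leq [X in _ && X]rankS ?subsetUr // andbT -e.
by apply: rankS; apply: setUS; apply: sub_closure.
Qed.

Lemma closure_min X Y : X \subset closure Y -> closure X \subset closure Y.
Proof. by move/closureS; rewrite closureK. Qed.

Lemma flatE X : flat M X = (closure X == X).
Proof.
apply/forallP/eqP => [fX | eX x].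
  apply/eqP; rewrite eqEsubset sub_closure andbT; apply/subsetP => x.
  rewrite mem_closure; apply: contraTT => xX.
  by have := fX x; rewrite xX /=; lia.
apply/implyP; rewrite -{1}eX mem_closure => ne.
by rewrite ltn_neqAle eq_sym ne rankS ?subsetUr.
Qed.

Lemma flat_closure X : flat M (closure X).
Proof. by rewrite flatE closureK. Qed.

(** * Circuits and cyclic sets *)

Lemma circuitP C :
  reflect (~~ indep M C /\ {in C, forall x, indep M (C :\ x)}) (circuit M C).
Proof.
apply: (iffP minsetP) => [[dC minC]|[dC iC]]; split=> //.
  move=> x xC; apply: contraT => d.
  by have := minC _ d (subsetDl _ _) => e; move: xC; rewrite -e !inE eqxx.
move=> B dB sBC; apply/eqP; rewrite eqEsubset sBC; apply: contraT.
case/subsetPn => x xC xB; case/negP: dB; apply: indep_sub (iC x xC).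
by rewrite subsetD1 sBC xB.
Qed.

Lemma circuit_sub X : ~~ indep M X -> exists2 C, circuit M C & C \subset X.
Proof.
move=> dX.
have [C mC sCX] := @minset_exists T (fun D : {set T} => ~~ indep M D) X dX.
by exists C.
Qed.

Lemma circuit_rankD1 C X x :
  circuit M C -> C \subset X -> x \in C -> rank M (X :\ x) = rank M X.
Proof.
move=> /circuitP[dC iC] sCX xC.
have xcl : x \in closure (C :\ x).
  rewrite mem_closure setD1K // eqn_leq [X in _ && X]rankS ?subsetDl // andbT.
  have e : #|C :\ x|.+1 = #|C| by rewrite (cardsD1 x C) xC.
  rewrite (rank_indep (iC x xC)) -ltnS e.
  by rewrite ltnNge; apply: contra dC; apply: indep_rank.
have : x \in closure (X :\ x).
  by apply: (subsetP (closureS _)) xcl; apply: setSD.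
by rewrite mem_closure setD1K ?(subsetP sCX) // => /eqP.
Qed.

(** A union of circuits is a set whose restriction has no coloop. For the converse, adding [x] to a
    basis of [X :\ x] gives a dependent set, and any circuit in it passes through [x]. *)
Lemma cyclicP X :
  reflect {in X, forall x, rank M (X :\ x) = rank M X} (cyclic M X).
Proof.
apply: (iffP eqP) => [eX x | cX].
  rewrite {1}eX => /bigcupP[C /andP[cC sCX]].
  exact: circuit_rankD1.
apply/eqP; rewrite eqEsubset; apply/andP; split; last first.
  by apply/bigcupsP => C /andP[].
apply/subsetP => x xX; have [I [iI sI eI]] := rank_basis (X :\ x).
have dxI : ~~ indep M (x |: I).
  have xI : x \notin I by apply/negP => /(subsetP sI); rewrite !inE eqxx.
  have sX : x |: I \subset X.
    by rewrite subUset sub1set xX (subset_trans sI (subsetDl _ _)).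
  by apply/negP => /rank_ge/(_ sX); rewrite cardsU1 xI eI cX // ltnn.
have [C cC sC] := circuit_sub dxI; apply/bigcupP; exists C.
  rewrite cC (subset_trans sC) // subUset sub1set xX.
  exact: subset_trans sI (subsetDl _ _).
apply: contraT => xC; have /circuitP[/negP[]] := cC; apply: indep_sub iI.
apply/subsetP => y yC; have := subsetP sC _ yC; rewrite !inE.
by case/orP => // /eqP eyx; rewrite -eyx yC in xC.
Qed.

Lemma cyclic_subD1 X Y x :
  cyclic M X -> X \subset Y -> x \in X -> rank M (Y :\ x) = rank M Y.
Proof.
move=> /cyclicP cX sXY xX.
have xcl : x \in closure (X :\ x) by rewrite mem_closure setD1K ?cX.
have := subsetP (closureS (setSD [set x] sXY)) _ xcl.
by rewrite mem_closure setD1K ?(subsetP sXY) // => /eqP.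
Qed.

Lemma cyclicU X Y : cyclic M X -> cyclic M Y -> cyclic M (X :|: Y).
Proof.
move=> cX cY; apply/cyclicP => x; rewrite inE => /orP[xX|xY].
  exact: cyclic_subD1 cX (subsetUl _ _) xX.
exact: cyclic_subD1 cY (subsetUr _ _) xY.
Qed.

Lemma cyclic_closure X : cyclic M X -> cyclic M (closure X).
Proof.
move=> cX; apply/cyclicP => x xcl; have [xX|xX] := boolP (x \in X).
  exact: cyclic_subD1 cX (sub_closure X) xX.
apply/eqP; rewrite eqn_leq rankS ?subsetDl //= rank_closure; apply: rankS.
by rewrite subsetD1 sub_closure.
Qed.

Lemma cyclic_circuit C : circuit M C -> cyclic M C.
Proof.
by move=> cC; apply/cyclicP => x; apply: circuit_rankD1.
Qed.

Lemma in_cyclic_flats X :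
  (X \in cyclic_flats M) = cyclic M X && flat M X.
Proof. by rewrite inE. Qed.

Lemma closure_cyclic_flat X : cyclic M X -> closure X \in cyclic_flats M.
Proof. by move=> cX; rewrite inE cyclic_closure // flat_closure. Qed.

Lemma cyclic_flat_closed F : F \in cyclic_flats M -> closure F = F.
Proof. by rewrite inE flatE => /andP[_ /eqP]. Qed.

(** A dependent set contains a circuit [C], whose closure is a cyclic flat of rank below [#|C|] and
    so violates the bound. This is what reduces an isomorphism to the images of the cyclic flats. *)
Lemma indep_cyclic_flatsP X :
  reflect (forall F, F \in cyclic_flats M -> #|X :&: F| <= rank M F)
          (indep M X).
Proof.
apply: (iffP idP) => [iX F _ | h].
  by apply: rank_ge (subsetIr _ _); apply: indep_sub iX; apply: subsetIl.
apply: contraT => /circuit_sub[C cC sCX].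
have := h _ (closure_cyclic_flat (cyclic_circuit cC)).
rewrite rank_closure => le; have /circuitP[/negP[]] := cC.
apply: indep_rank; apply: leq_trans le; apply: subset_leq_card.
by rewrite subsetI sCX sub_closure.
Qed.

(** * Cyclic parts, loops and coloops *)

(** The union of the circuits inside [X], that is, [X] without the coloops of the restriction to
    [X]. *)
Definition cyclic_part X : {set T} := [set x in X | rank M (X :\ x) == rank M X].

Lemma cyclic_part_sub X : cyclic_part X \subset X.
Proof. by apply/subsetP => x; rewrite inE => /andP[]. Qed.

(** Coloops are shed one at a time: [z] lies outside the closure of [X :\ z], hence outside the
    closure of the smaller set [X :\: Z]. *)
Lemma rank_coloops X Z :
  Z \subset X -> {in Z, forall x, rank M (X :\ x) < rank M X} ->
  rank M X = rank M (X :\: Z) + #|Z|.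
Proof.
have [k] := ubnP #|Z|; elim: k Z => // k IHk Z ltk sZ cZ.
have [->|[z zZ]] := set_0Vmem Z; first by rewrite setD0 cards0 addn0.
have sZ' : Z :\ z \subset X by apply: subset_trans sZ; apply: subsetDl.
have ltZ : #|Z :\ z| < k by move: ltk; rewrite (cardsD1 z Z) zZ; lia.
rewrite (IHk _ ltZ sZ'); last by move=> x; rewrite inE => /andP[_]; apply: cZ.
rewrite (cardsD1 z Z) zZ add1n addnS -addSn; congr (_ + _).
have -> : X :\: (Z :\ z) = z |: (X :\: Z).
  apply/setP => y; rewrite !inE; case: (eqVneq y z) => //= ->.
  by rewrite (subsetP sZ).
apply/eqP; rewrite eqn_leq rankU1 /=.
rewrite ltn_neqAle rankS ?subsetUr // andbT eq_sym -mem_closure.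
have sXZ : X :\: Z \subset X :\ z by rewrite subsetD1 subsetDl !inE zZ.
apply/negP => /(subsetP (closureS sXZ)).
rewrite mem_closure setD1K ?(subsetP sZ) // => /eqP e.
by have := cZ z zZ; rewrite e ltnn.
Qed.

Lemma rank_cyclic_part X :
  rank M X = rank M (cyclic_part X) + #|X :\: cyclic_part X|.
Proof.
rewrite (@rank_coloops X (X :\: cyclic_part X)) ?subsetDl //.
  congr (rank M _ + _); apply/setP => x; rewrite !inE.
  by case: (x \in X) => //=; case: eqP.
move=> x; rewrite !inE => /andP[+ xX]; rewrite xX /= => ne.
by rewrite ltn_neqAle ne rankS ?subsetDl.
Qed.

Lemma cyclic_partP X : cyclic M (cyclic_part X).
Proof.
apply/cyclicP => x xG; have xX := subsetP (cyclic_part_sub X) _ xG.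
apply/eqP; rewrite eqn_leq rankS ?subsetDl //= leqNgt; apply/negP => lt.
have := xG; rewrite inE xX /= => /eqP e.
have : rank M (X :\ x) < rank M X; last by rewrite e ltnn.
rewrite (rank_cyclic_part X).
apply: leq_ltn_trans
  (_ : rank M (cyclic_part X :\ x) + #|X :\: cyclic_part X| < _).
  apply: leq_trans (rankU _ _); apply: rankS; apply/subsetP => y.
  by rewrite !inE; case: (y == x); case: (y \in X); case: (_ == _).
by rewrite ltn_add2r.
Qed.

(** A point of the closure lies in [X] because [X] is flat. Outside the cyclic part it would be a
    coloop of the restriction to [X], yet [X :\ x] spans it. *)
Lemma cyclic_part_flat X : flat M X -> cyclic_part X \in cyclic_flats M.
Proof.
move=> fX; rewrite in_cyclic_flats cyclic_partP flatE eqEsubset sub_closure.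
rewrite andbT; apply/subsetP => x xcl.
have xX : x \in X.
  move: fX; rewrite flatE => /eqP <-.
  by apply: (subsetP (closureS (cyclic_part_sub X))).
apply: contraT => xG.
have := xG; rewrite inE xX /= => /negP[].
have : x \in closure (X :\ x).
  apply: (subsetP (closureS _)) xcl.
  by rewrite subsetD1 cyclic_part_sub.
by rewrite mem_closure setD1K // eq_sym.
Qed.

Lemma closureI X Y : closure (X :&: Y) \subset closure X :&: closure Y.
Proof. by rewrite subsetI !closureS ?subsetIl ?subsetIr. Qed.

Lemma flatI X Y : flat M X -> flat M Y -> flat M (X :&: Y).
Proof.
rewrite !flatE => /eqP eX /eqP eY.
by rewrite eqEsubset sub_closure andbT -{2}eX -{2}eY closureI.
Qed.

Definition noncoloops : {set T} := cyclic_part setT.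
Definition loops : {set T} := closure set0.

Lemma noncoloopsE x : (x \in noncoloops) = (rank M (~: [set x]) == rank M setT).
Proof. by rewrite !inE /= setTD. Qed.

Lemma loopsE x : (x \in loops) = ~~ indep M [set x].
Proof.
rewrite mem_closure setU0 rank0; apply/eqP/negP => [r0 i1 | d1].
  by have := rank_indep i1; rewrite r0 cards1.
apply/eqP; rewrite eqn_leq andbT leqNgt; apply/negP => lt.
by case: d1; apply: indep_rank; rewrite cards1.
Qed.

Lemma sub_noncoloops X : cyclic M X -> X \subset noncoloops.
Proof.
move=> cX; apply/subsetP => x xX; rewrite inE in_setT /=.
by rewrite (cyclic_subD1 cX (subsetT X) xX).
Qed.

Lemma loops_sub X : X \in cyclic_flats M -> loops \subset X.
Proof.
by move/cyclic_flat_closed <-; apply: closureS; apply: sub0set.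
Qed.

Lemma cyclic0 : cyclic M set0.
Proof. by apply/cyclicP => x; rewrite inE. Qed.

Lemma loops_cyclic_flat : loops \in cyclic_flats M.
Proof. exact: closure_cyclic_flat cyclic0. Qed.

Lemma flatT : flat M setT.
Proof. by rewrite flatE eqEsubset subsetT sub_closure. Qed.

Lemma noncoloops_cyclic_flat : noncoloops \in cyclic_flats M.
Proof. exact: cyclic_part_flat flatT. Qed.

Lemma rank_noncoloops X : rank M X = rank M (X :&: noncoloops) + #|X :\: noncoloops|.
Proof.
rewrite (@rank_coloops X (X :\: noncoloops)) ?subsetDl //.
  by rewrite setDDr setDv set0U.
move=> x; rewrite inE => /andP[xc xX].
rewrite ltn_neqAle rankS ?subsetDl // andbT; apply: contra xc => /eqP e.
have : x \in closure (X :\ x) by rewrite mem_closure setD1K // e.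
move/(subsetP (closureS (setSD [set x] (subsetT X)))).
by rewrite mem_closure setD1K ?in_setT // noncoloopsE setTD eq_sym.
Qed.

Lemma closure_noncoloops x X :
  x \in noncoloops -> x \in closure X -> x \in closure (X :&: noncoloops).
Proof.
move=> xc; rewrite !mem_closure (rank_noncoloops X) (rank_noncoloops (x |: X)).
have -> : (x |: X) :&: noncoloops = x |: (X :&: noncoloops).
  by rewrite setIUl (setIidPl _) // sub1set.
have -> : (x |: X) :\: noncoloops = X :\: noncoloops.
  apply/setP => y; rewrite !inE; case: (eqVneq y x) => //= ->.
  by move: xc; rewrite !inE /= => ->.
by rewrite eqn_add2r.
Qed.

(* Every cyclic flat lies between [loops] and [noncoloops]. *)
Definition core X : {set T} := (X :&: noncoloops) :|: loops.

Lemma coreS X Y : X \subset Y -> core X \subset core Y.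
Proof. by move=> sXY; apply: setSU; apply: setSI. Qed.

Lemma loops_noncoloops : loops \subset noncoloops.
Proof. exact: loops_sub noncoloops_cyclic_flat. Qed.

Lemma coreT : core setT = noncoloops.
Proof. by rewrite /core setTI (setUidPl loops_noncoloops). Qed.

Lemma core0 : core set0 = loops.
Proof. by rewrite /core set0I set0U. Qed.

Lemma coreU X Y : core (X :|: Y) = core X :|: core Y.
Proof. by rewrite /core setIUl setUUl. Qed.

Lemma coreI X Y : core (X :&: Y) = core X :&: core Y.
Proof. by rewrite /core setIIl setUIl. Qed.

Lemma rank_core X : rank M (core X) + #|X :\: noncoloops| = rank M X.
Proof.
rewrite /core rankU_closure ?(rank_noncoloops X) //.
by apply: closureS; apply: sub0set.
Qed.

Lemma core_sub_closure X : core X \subset closure X.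
Proof.
rewrite subUset (subset_trans (subsetIl _ _) (sub_closure X)).
by rewrite closureS ?sub0set.
Qed.

(** The number of coloops in a set is a modular function, and [core] lowers the rank by exactly this
    number. *)
Lemma core_modular X Y :
  rank M X + rank M Y <= rank M (X :|: Y) + rank M (X :&: Y) ->
  rank M (core X) + rank M (core Y) <=
    rank M (core X :|: core Y) + rank M (core X :&: core Y).
Proof.
rewrite -coreU -coreI.
have := rank_core X; have := rank_core Y; have := rank_core (X :|: Y).
have := rank_core (X :&: Y); rewrite setDUl setDIl.
by have := cardsUI (X :\: noncoloops) (Y :\: noncoloops); lia.
Qed.

(** Trades a condition on [core X] for one on [X]: a noncoloop spanned by a set is spanned by the
    noncoloops of that set, and a loop is spanned by every set. *)
Lemma core_cyclic X :
  {in X :&: noncoloops, forall x, x \in closure (X :\ x)} -> cyclic M (core X).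
Proof.
move=> hcyc; apply/cyclicP => x xc; apply/esym/eqP.
rewrite -{1}(setD1K xc) -mem_closure.
move: xc; rewrite inE => /orP[xX|xl]; last first.
  by apply: (subsetP (closureS _)) xl; apply: sub0set.
have := hcyc x xX; have := xX; rewrite inE => /andP[_ xc].
move/(closure_noncoloops xc); apply: (subsetP (closureS _)).
apply/subsetP => y; rewrite /core !in_setD1 !(in_setI, in_setU, in_setD1).
by case/andP=> /andP[-> ->] ->.
Qed.

Lemma core_flat X :
  {in noncoloops :&: closure X, forall x, x \in X :|: loops} -> flat M (core X).
Proof.
move=> hflat; rewrite flatE eqEsubset sub_closure andbT; apply/subsetP => x xcl.
have xc : x \in noncoloops.
  rewrite -(cyclic_flat_closed noncoloops_cyclic_flat).
  apply: (subsetP (closureS _)) xcl.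
  by rewrite subUset subsetIr loops_noncoloops.
have := hflat x; rewrite !in_setI in_setU xc /=.
rewrite (subsetP (closure_min (core_sub_closure X)) _ xcl) => /(_ isT).
by rewrite /core in_setU in_setI xc andbT.
Qed.

End Rank.

(** * Transporting two chains of cyclic flats *)

Lemma in_bij_card (T U : finType) (g : T -> U) (D : {set T}) (D' : {set U}) :
  #|D| = #|D'| -> exists2 f : T -> U, {in D &, injective f} & f @: D = D'.
Proof.
(* [g x] is the default value of [nth]; on [D] the index stays in range. *)
move=> eD; pose f x := nth (g x) (enum D') (index x (enum D)).
have idx x : x \in D -> index x (enum D) < size (enum D').
  by move=> xD; rewrite -cardE -eD cardE index_mem mem_enum.
have injf : {in D &, injective f}.
  move=> x y xD yD; rewrite /f (set_nth_default (g y)) ?idx //.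
  move/eqP; rewrite nth_uniq ?idx ?enum_uniq // => /eqP e.
  by rewrite -(nth_index x (s := enum D) (x := x)) ?mem_enum // e
    nth_index ?mem_enum.
exists f => //; apply/eqP; rewrite eqEcard card_in_imset // eD leqnn andbT.
apply/subsetP => _ /imsetP[x xD ->]; rewrite -mem_enum.
by apply: mem_nth; apply: idx.
Qed.

(* K is meant to be the family of all intersections of members of L, paired
   with the corresponding intersections on the other side. *)
Lemma bij_of_card_meets (T U : finType) (g : T -> U)
    (K : {set T} -> {set U} -> Prop) (L : seq ({set T} * {set U}))
    (D : {set T}) (D' : {set U}) :
  K setT setT ->
  (forall p Y Y', p \in L -> K Y Y' -> K (p.1 :&: Y) (p.2 :&: Y')) ->
  (forall Y Y', K Y Y' -> #|D :&: Y| = #|D' :&: Y'|) ->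
  exists f : T -> U, [/\ {in D &, injective f}, f @: D = D' &
    forall p x, p \in L -> x \in D -> (f x \in p.2) = (x \in p.1)].
Proof.
(* [D] and [D'] are split along the first pair [(X, X')]. Counts agree on the parts inside because
   [K] is closed under the pair, and on the parts outside by subtraction; the two bijections
   obtained by induction are then glued. *)
move=> KT; elim: L D D' => [|[X X'] L IHL] D D' KI cK.
  have [|f injf fD] := @in_bij_card T U g D D'.
    by have := cK _ _ KT; rewrite !setIT.
  by exists f; split.
have KIL p Y Y' : p \in L -> K Y Y' -> K (p.1 :&: Y) (p.2 :&: Y').
  by move=> pL; apply: KI; rewrite inE pL orbT.
have KX Y Y' : K Y Y' -> K (X :&: Y) (X' :&: Y').
  by apply: (KI (X, X')); rewrite mem_head.
have cI Y Y' : K Y Y' -> #|D :&: X :&: Y| = #|D' :&: X' :&: Y'|.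
  by move=> KY; rewrite -!setIA; apply/cK/KX.
have cD Y Y' : K Y Y' -> #|(D :\: X) :&: Y| = #|(D' :\: X') :&: Y'|.
  move=> KY; have := cK _ _ KY; have := cI _ _ KY.
  have := cardsID X (D :&: Y); have := cardsID X' (D' :&: Y').
  by rewrite !setIDAC (setIAC D) (setIAC D'); lia.
have [f1 [inj1 im1 f1L]] := IHL _ _ KIL cI.
have [f2 [inj2 im2 f2L]] := IHL _ _ KIL cD.
pose f x := if x \in X then f1 x else f2 x.
have f1X x : x \in D -> x \in X -> f1 x \in D' :&: X'.
  by move=> xD xX; rewrite -im1; apply: imset_f; rewrite inE xD.
have f2X x : x \in D -> x \notin X -> f2 x \in D' :\: X'.
  by move=> xD xX; rewrite -im2; apply: imset_f; rewrite inE xD xX.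
have fX x : x \in D -> (f x \in X') = (x \in X).
  move=> xD; rewrite /f; case: ifPn => xX.
    by have := f1X x xD xX; rewrite inE => /andP[].
  by have := f2X x xD xX; rewrite inE => /andP[/negPf].
exists f; split.
- move=> x y xD yD e; have := fX x xD; rewrite e fX //.
  move: e; rewrite /f; case: ifPn => xX; case: ifPn => yX // e _.
    by apply: inj1 e; rewrite inE ?xD ?yD.
  by apply: inj2 e; rewrite inE ?xX ?yX.
- apply/setP => u; apply/imsetP/idP => [[x xD ->]|uD'].
    rewrite /f; case: ifPn => xX.
      by have := f1X x xD xX; rewrite inE => /andP[].
    by have := f2X x xD xX; rewrite inE => /andP[].
  have [uX|uX] := boolP (u \in X').
    have : u \in D' :&: X' by rewrite inE uD'.
    rewrite -im1 => /imsetP[x]; rewrite inE => /andP[xD xX] ->.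
    by exists x; rewrite /f ?xX.
  have : u \in D' :\: X' by rewrite inE uD' uX.
  rewrite -im2 => /imsetP[x]; rewrite inE => /andP[xX xD] ->.
  by exists x; rewrite // /f (negPf xX).
- move=> p x; rewrite inE => /orP[/eqP->|pL] xD; first exact: fX.
  rewrite /f; case: ifPn => xX.
    by apply: f1L; rewrite // inE xD.
  by apply: f2L; rewrite // inE xX.
Qed.

(** * Sizes of intersections under a configuration isomorphism *)

Section Configuration.

Variables (T U : finType) (M : matroid T) (N : matroid U).
Variable Phi : {set T} -> {set U}.
Hypothesis Phi_im : Phi @: cyclic_flats M = cyclic_flats N.
Hypothesis Phi_mono :
  {in cyclic_flats M &, {mono Phi : X Y / X \subset Y}}.
Hypothesis Phi_card : {in cyclic_flats M, forall X, #|Phi X| = #|X|}.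
Hypothesis Phi_rank :
  {in cyclic_flats M, forall X, rank N (Phi X) = rank M X}.

Lemma Phi_cyclic_flat F : F \in cyclic_flats M -> Phi F \in cyclic_flats N.
Proof. by move=> zF; rewrite -Phi_im imset_f. Qed.

(** The closure of [Phi A :|: Phi B] is a cyclic flat, hence some [Phi C], and [C] contains [A] and
    [B] because [Phi] reflects inclusion. *)
Lemma rank_PhiU A B :
  A \in cyclic_flats M -> B \in cyclic_flats M ->
  rank M (A :|: B) <= rank N (Phi A :|: Phi B).
Proof.
move=> zA zB; have zA' := Phi_cyclic_flat zA; have zB' := Phi_cyclic_flat zB.
have : closure N (Phi A :|: Phi B) \in cyclic_flats N.
  move: zA' zB'; rewrite !in_cyclic_flats => /andP[cA _] /andP[cB _].
  by rewrite cyclic_closure ?cyclicU // flat_closure.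
rewrite -{1}Phi_im => /imsetP[C zC eC].
rewrite -(rank_closure N) eC Phi_rank //; apply: rankS.
by rewrite subUset -!Phi_mono // -eC;
  rewrite !(subset_trans _ (sub_closure N _)) ?subsetUl ?subsetUr.
Qed.

(* The nullity of a flat is the nullity of its cyclic part, which corresponds
   to a cyclic flat of M inside A :&: B. *)
Lemma card_PhiI_le A B :
  A \in cyclic_flats M -> B \in cyclic_flats M ->
  rank M A + rank M B <= rank M (A :|: B) + rank M (A :&: B) ->
  #|Phi A :&: Phi B| <= #|A :&: B|.
Proof.
move=> zA zB mod; have zA' := Phi_cyclic_flat zA; have zB' := Phi_cyclic_flat zB.
have fAB : flat N (Phi A :&: Phi B).
  by move: zA' zB'; rewrite !in_cyclic_flats => /andP[_ fA] /andP[_]; apply: flatI.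
have := cyclic_part_flat fAB; have := cyclic_part_sub N (Phi A :&: Phi B).
have := rank_cyclic_part N (Phi A :&: Phi B).
set G := cyclic_part _ _ => rG sG; rewrite -Phi_im => /imsetP[H zH eG].
have sH : H \subset A :&: B.
  move: sG; rewrite eG subsetI => /andP[].
  by rewrite !Phi_mono // subsetI => -> ->.
have cG : #|Phi A :&: Phi B| = #|G| + #|(Phi A :&: Phi B) :\: G|.
  by rewrite -(cardsID G (Phi A :&: Phi B)) (setIidPr sG).
have rH : rank M (A :&: B) <= rank M H + #|(A :&: B) :\: H|.
  apply: leq_trans (rankU _ _ _); apply: rankS.
  by apply/subsetP => x xAB; rewrite !(inE, xAB); case: (x \in H); rewrite //= -in_setI.
have cH : #|A :&: B| = #|H| + #|(A :&: B) :\: H|.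
  by rewrite -(cardsID H (A :&: B)) (setIidPr sH).
have := rank_submod N (Phi A) (Phi B); have := rank_PhiU zA zB.
by move: cG rG; rewrite eG !Phi_rank ?Phi_card //; lia.
Qed.

(** The missing lower bound comes from the extreme cyclic flats. If [A] and [B] meet in the loops,
    both images contain [Phi] of the loops; if they cover the noncoloops, both images lie in [Phi]
    of the noncoloops, and inclusion-exclusion bounds the intersection from below. *)
Lemma card_PhiI A B :
  A \in cyclic_flats M -> B \in cyclic_flats M ->
  rank M A + rank M B <= rank M (A :|: B) + rank M (A :&: B) ->
  A :&: B = loops M \/ A :|: B = noncoloops M ->
  #|Phi A :&: Phi B| = #|A :&: B|.
Proof.
move=> zA zB mod eAB; apply/eqP; rewrite eqn_leq card_PhiI_le //=.
case: eAB => [->|eU].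
  rewrite -(Phi_card (loops_cyclic_flat M)); apply: subset_leq_card.
  by rewrite subsetI !Phi_mono ?loops_cyclic_flat // !loops_sub.
have : #|Phi A :|: Phi B| <= #|noncoloops M|.
  rewrite -(Phi_card (noncoloops_cyclic_flat M)); apply: subset_leq_card.
  rewrite subUset !Phi_mono ?noncoloops_cyclic_flat //.
  by move: zA zB; rewrite !in_cyclic_flats => /andP[cA _] /andP[cB _];
    rewrite !sub_noncoloops.
rewrite -eU; have := cardsUI (Phi A) (Phi B); have := cardsUI A B.
by rewrite !Phi_card //; lia.
Qed.

Hypothesis eTU : #|T| = #|U|.
Variables AA BB : {set {set T}}.
Hypothesis AA_flats : AA \subset cyclic_flats M.
Hypothesis BB_flats : BB \subset cyclic_flats M.
Hypothesis AA_chain :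
  {in AA &, forall A A' : {set T}, (A \subset A') || (A' \subset A)}.
Hypothesis BB_chain :
  {in BB &, forall B B' : {set T}, (B \subset B') || (B' \subset B)}.
Hypothesis AB_modular : forall A B, A \in AA -> B \in BB ->
  rank M A + rank M B <= rank M (A :|: B) + rank M (A :&: B).
Hypothesis AB_cover : forall A B, A \in AA -> B \in BB ->
  A :&: B = loops M \/ A :|: B = noncoloops M.
Hypothesis AB_generate : forall F z, F \in cyclic_flats M -> z \notin F ->
  exists A B, [/\ A \in AA, B \in BB, A :|: B \in cyclic_flats M,
                  F \subset A :|: B & z \notin A :|: B].

Lemma exists_chain_bijection :
  exists2 f : T -> U, bijective f & forall A, A \in AA :|: BB -> f @: A = Phi A.
Proof.
(* [E] pairs an intersection of members of one chain with its image: it is a member of the chain, or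
   the full set for the empty intersection. [K] combines one such intersection from each chain. *)
pose E (CC : {set {set T}}) (X : {set T}) (X' : {set U}) :=
  X = setT /\ X' = setT \/ X \in CC /\ X' = Phi X.
pose K (Y : {set T}) (Y' : {set U}) := exists X1 X1' X2 X2',
  [/\ E AA X1 X1', E BB X2 X2', Y = X1 :&: X2 & Y' = X1' :&: X2'].
have ET CC : E CC setT setT by left.
have EI (CC : {set {set T}}) : CC \subset cyclic_flats M ->
    {in CC &, forall A A' : {set T}, (A \subset A') || (A' \subset A)} ->
    forall C X X', C \in CC -> E CC X X' -> E CC (C :&: X) (Phi C :&: X').
  move=> /subsetP zC chain C X X' CC1 [[-> ->]|[XC ->]].
    by right; rewrite !setIT.
  right; have [sCX|sXC] := orP (chain C X CC1 XC).
    by rewrite !(setIidPl _) ?Phi_mono // ?zC.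
  by rewrite !(setIidPr _) ?Phi_mono // ?zC.
pose L := [seq (A, Phi A) | A <- enum (AA :|: BB)].
have zA A : A \in AA -> A \in cyclic_flats M by apply: (subsetP AA_flats).
have zB B : B \in BB -> B \in cyclic_flats M by apply: (subsetP BB_flats).
have [g _] : exists g : T -> U, injective g.
  exists (fun x => enum_val (cast_ord eTU (enum_rank x))).
  by move=> x y /enum_val_inj/cast_ord_inj/enum_rank_inj.
have [|||f [injf fT fL]] := @bij_of_card_meets T U g K L setT setT.
- by exists setT, setT, setT, setT; rewrite !setIT; split.
- move=> p Y Y' /mapP[C]; rewrite mem_enum inE => + -> /=.
  move=> + [X1 [X1' [X2 [X2' [E1 E2 -> ->]]]]] => /orP[CA|CB].
    exists (C :&: X1), (Phi C :&: X1'), X2, X2'.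
    by rewrite !setIA; split=> //; apply: EI.
  exists X1, X1', (C :&: X2), (Phi C :&: X2').
  by rewrite !(setICA C) !(setICA (Phi C)); split=> //; apply: EI.
- move=> Y Y' [X1 [X1' [X2 [X2' [E1 E2 -> ->]]]]]; rewrite !setTI.
  case: E1 E2 => [[-> ->]|[XA ->]] [[-> ->]|[XB ->]].
  + by rewrite !setIT !cardsT.
  + by rewrite !setTI Phi_card ?zB.
  + by rewrite !setIT Phi_card ?zA.
  + by apply/esym/card_PhiI; [apply: zA|apply: zB|apply: AB_modular|apply: AB_cover].
have injf' : injective f by move=> x y; apply: injf; rewrite inE.
exists f; first by apply: inj_card_bij; rewrite // eTU.
move=> A AAB; have memA x : (f x \in Phi A) = (x \in A).
  by apply: (fL (A, Phi A)); rewrite ?inE // map_f // mem_enum.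
apply/setP => u; have : u \in f @: setT by rewrite fT inE.
case/imsetP => x _ ->; rewrite memA; apply/imsetP/idP => [[y yA /injf' ->]|xA] //.
by exists x.
Qed.

(** The image of [A :|: B] lies in [Phi (A :|: B)] and has the same size, so the two agree. For any
    other cyclic flat [F], a point outside [F] is missed by some such union above [F], so its image
    is outside [Phi F]; equality again follows from the sizes. *)
Lemma isomorphic_of_chains : isomorphic M N.
Proof.
have [f bf fAB] := exists_chain_bijection.
have injf := bij_inj bf.
have fU A B : A \in AA -> B \in BB -> A :|: B \in cyclic_flats M ->
    f @: (A :|: B) = Phi (A :|: B).
  move=> AA1 BB1 zAB; apply/eqP; rewrite eqEcard Phi_card // card_imset // leqnn.
  have zA := subsetP AA_flats _ AA1; have zB := subsetP BB_flats _ BB1.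
  by rewrite andbT imsetU !fAB ?inE ?AA1 ?BB1 ?orbT // subUset !Phi_mono //
    subsetUl subsetUr.
have fF F : F \in cyclic_flats M -> f @: F = Phi F.
  move=> zF; apply/esym/eqP; rewrite eqEcard Phi_card // card_imset // leqnn andbT.
  apply/subsetP => u uF; have [h _ hK] := bf; rewrite -(hK u) in uF *.
  move: (h u) uF => z zPhi; rewrite imset_f //; apply: contraT => zF'.
  have [A [B [AA1 BB1 zAB sF zn]]] := AB_generate zF zF'.
  have : f z \in Phi (A :|: B) by apply: (subsetP _ _ zPhi); rewrite Phi_mono.
  by rewrite -fU // mem_imset // (negPf zn).
exists f => // X; apply/indep_cyclic_flatsP/indep_cyclic_flatsP => h F.
  move=> zF; have := h _ (Phi_cyclic_flat zF).
  by rewrite Phi_rank // -fF // -imsetI ?card_imset // => x y _ _; apply: injf.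
rewrite -Phi_im => /imsetP[G zG ->]; rewrite Phi_rank // -fF //.
by rewrite -imsetI ?card_imset ?h // => x y _ _; apply: injf.
Qed.

End Configuration.

(** * Matroids defined by a pair of height functions *)

Section Segments.

Variable n : nat.
Implicit Types (X Y I : {set 'I_n}) (s t a b : nat) (h : nat -> nat).

(* x : 'I_n stands for the step from x to x.+1, so that seg s t is the interval
   (s, t] of [n]. *)
Definition seg s t : {set 'I_n} := [set x : 'I_n | s <= x < t].

Lemma mem_seg s t (x : 'I_n) : (x \in seg s t) = (s <= x < t).
Proof. by rewrite inE. Qed.

Definition cnt X s t := #|X :&: seg s t|.

Lemma cntS X Y s t : X \subset Y -> cnt X s t <= cnt Y s t.
Proof. by move=> sXY; apply/subset_leq_card/setSI. Qed.

Lemma cnt_wide X s s' t t' : s' <= s -> t <= t' -> cnt X s t <= cnt X s' t'.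
Proof.
move=> les let_; apply/subset_leq_card/setIS/subsetP => x; rewrite !mem_seg.
by lia.
Qed.

Lemma cntU X Y s t : cnt (X :|: Y) s t <= cnt X s t + cnt Y s t.
Proof. by rewrite /cnt setIUl cardsU leq_subr. Qed.

Lemma cnt_ge X s t : t <= s -> cnt X s t = 0.
Proof.
move=> le; apply/eqP; rewrite cards_eq0; apply/eqP/setP => x.
by rewrite !inE; apply/negP => /andP[_]; lia.
Qed.

Lemma cnt_cat X s t u : s <= t <= u -> cnt X s u = cnt X s t + cnt X t u.
Proof.
move=> le; rewrite /cnt -cardsUI.
have -> : X :&: seg s t :|: X :&: seg t u = X :&: seg s u.
  by apply/setP => x; rewrite !inE -andb_orr; congr (_ && _); lia.
have -> : X :&: seg s t :&: (X :&: seg t u) = set0; last by rewrite cards0 addn0.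
by apply/setP => x; rewrite !inE; apply/negP => /andP[/andP[_ ?] /andP[_]]; lia.
Qed.

Lemma cnt_set1 (x : 'I_n) s t : cnt [set x] s t = (s <= x < t).
Proof.
rewrite /cnt; have [le|nle] := boolP (s <= x < t).
  by rewrite (setIidPl _) ?cards1 // sub1set mem_seg.
apply/eqP; rewrite cards_eq0; apply/eqP/setP => y; rewrite !inE.
by apply/negP => /andP[/eqP->]; apply/negP.
Qed.

Lemma cnt_notin X (x : 'I_n) : x \notin X -> cnt X x x.+1 = 0.
Proof.
move=> xX; apply/eqP; rewrite cards_eq0; apply/eqP/setP => y; rewrite !inE.
apply/negP => /andP[yX le]; have e : y = x by apply: val_inj => /=; lia.
by rewrite -e yX in xX.
Qed.

Lemma cnt_in X (x : 'I_n) : x \in X -> cnt X x x.+1 = 1.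
Proof.
move=> xX; apply: (@eq_card1 _ x) => y; rewrite !inE.
apply/andP/eqP => [[yX le]|->]; first by apply: val_inj => /=; lia.
by split=> //; lia.
Qed.

Lemma cntU1 X (x : 'I_n) s t :
  x \notin X -> cnt (x |: X) s t = (s <= x < t) + cnt X s t.
Proof.
move=> xX; rewrite -cnt_set1 /cnt setIUl -cardsUI.
have -> : [set x] :&: seg s t :&: (X :&: seg s t) = set0; last by rewrite cards0 addn0.
by apply/setP => y; rewrite !inE; case: eqP => //= ->; rewrite (negPf xX) andbF.
Qed.

Lemma cnt_full X s t : X \subset seg s t -> cnt X s t = #|X|.
Proof. by move=> sX; rewrite /cnt (setIidPl sX). Qed.

Lemma seg_full : seg 0 n = setT.
Proof. by apply/setP => x; rewrite !inE ltn_ord. Qed.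

Lemma cnt0n X : cnt X 0 n = #|X|.
Proof. by rewrite cnt_full // seg_full. Qed.

Lemma cnt_seg X a b s t : cnt (X :&: seg a b) s t = cnt X (maxn a s) (minn b t).
Proof.
congr #|pred_of_set _|; apply/setP => x; rewrite !inE -andbA; congr (_ && _).
by lia.
Qed.

Lemma cnt_sub_seg X a b s t :
  X \subset seg a b -> cnt X s t = cnt X (maxn a s) (minn b t).
Proof. by move=> sX; rewrite -cnt_seg (setIidPl sX). Qed.

(* A word in the letters N and E is encoded by its height function. *)
Definition unit_steps h := forall k, h k <= h k.+1 <= (h k).+1.

(** The north steps of the path with height function [h]. Pieces of such sets are the explicit
    independent sets behind most rank lower bounds below. *)
Definition up h : {set 'I_n} := [set x : 'I_n | h x < h x.+1].

Lemma unit_steps_le h s t : unit_steps h -> s <= t -> h s <= h t <= h s + (t - s).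
Proof.
move=> uh /subnK <-; elim: (t - s) => [|k IHk]; first by rewrite add0n; lia.
by have := uh (k + s); rewrite addSn; lia.
Qed.

Lemma cnt_up h s t : unit_steps h -> t <= n -> cnt (up h) s t = h t - h s.
Proof.
move=> uh; elim: t => [|t IHt] letn.
  by rewrite cnt_ge //; have := unit_steps_le uh (leq0n s); lia.
have [lts|] := ltnP t s.
  by rewrite cnt_ge //; have := unit_steps_le uh lts; lia.
move=> lest; rewrite (@cnt_cat _ s t) ?lest ?leqnSn // IHt ?(ltnW letn) //.
have := uh t; have := unit_steps_le uh lest.
have [xu|xu] := boolP (Ordinal letn \in up h).
  by have /= -> := cnt_in xu; move: xu; rewrite inE /=; lia.
by have /= -> := cnt_notin xu; move: xu; rewrite inE /=; lia.
Qed.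

Lemma card_seg s t : t <= n -> #|seg s t| = t - s.
Proof.
(* The identity is the height function of the path with north steps only. *)
move=> letn; have uid : unit_steps id by move=> k; rewrite leqnSn leqnn.
rewrite -(cnt_up s uid letn) -(setTI (seg s t)) -/(cnt setT s t).
by congr cnt; apply/setP => x; rewrite !inE ltnSn.
Qed.

End Segments.

(** * Ranks of prefixes and suffixes *)

Section Band.

Variables (n : nat) (M : matroid 'I_n) (lo hi : nat -> nat).
Hypothesis lo0 : lo 0 = 0.
Hypothesis hi0 : hi 0 = 0.
Hypothesis lo_hi_end : lo n = hi n.
Hypothesis lo_le_hi : forall k, lo k <= hi k.
Hypothesis lo_steps : unit_steps lo.
Hypothesis hi_steps : unit_steps hi.
Hypothesis indepP : forall X : {set 'I_n},
  reflect (forall s t, s <= t <= n -> cnt X s t + lo s <= hi t) (indep M X).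

Lemma lo_mono s t : s <= t -> lo s <= lo t <= lo s + (t - s).
Proof. exact: unit_steps_le. Qed.

Lemma hi_mono s t : s <= t -> hi s <= hi t <= hi s + (t - s).
Proof. exact: unit_steps_le. Qed.

(** Clip an interval from [s] to [t] to the range from [a] to [b]: there the path gains at most [hi]
    at the right end minus [lo] at the left end, and both height functions are monotone. *)
Lemma indep_up h a b : unit_steps h -> b <= n ->
  (forall k, a <= k <= b -> lo k <= h k <= hi k) ->
  indep M (up n h :&: seg n a b).
Proof.
move=> uh leb bh; apply/indepP => s t lest; rewrite cnt_seg cnt_up //; last by lia.
have [ltm|le] := ltnP (minn b t) (maxn a s).
  have := unit_steps_le uh (ltnW ltm); have := lo_le_hi t.
  by have := @lo_mono s t; lia.
have := bh (maxn a s); have := bh (minn b t); have := unit_steps_le uh le.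
have := @hi_mono (minn b t) t; have := @lo_mono s (maxn a s).
by lia.
Qed.

Lemma card_up h a b : unit_steps h -> b <= n ->
  #|up n h :&: seg n a b| = h b - h a.
Proof. by move=> uh leb; rewrite -/(cnt _ a b) cnt_up. Qed.

Lemma indep_up_hi a : a <= n -> indep M (up n hi :&: seg n 0 a).
Proof. by move=> lea; apply: indep_up => // k _; rewrite lo_le_hi leqnn. Qed.

Lemma indep_up_lo p : indep M (up n lo :&: seg n p n).
Proof. by apply: indep_up => // k _; rewrite lo_le_hi leqnn. Qed.

Lemma rank_sub_seg (X : {set 'I_n}) s t :
  s <= t <= n -> X \subset seg n s t -> rank M X + lo s <= hi t.
Proof.
move=> lest sX; have [I [iI sI <-]] := rank_basis M X.
by rewrite -(cnt_full (subset_trans sI sX)); apply/indepP.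
Qed.

Lemma rank_prefix a : a <= n -> rank M (seg n 0 a) = hi a.
Proof.
move=> lea; apply/eqP; rewrite eqn_leq; apply/andP; split.
  by have := @rank_sub_seg (seg n 0 a) 0 a; rewrite lo0 addn0; apply.
have := card_up 0 hi_steps lea; rewrite hi0 subn0 => <-.
by apply: rank_ge; [apply: indep_up_hi|apply: subsetIr].
Qed.

Lemma rank_suffix p : p <= n -> rank M (seg n p n) = hi n - lo p.
Proof.
move=> lep; apply/eqP; rewrite eqn_leq; apply/andP; split.
  by have := @rank_sub_seg (seg n p n) p n; rewrite lep leqnn subxx; lia.
rewrite -{1}lo_hi_end -(card_up p lo_steps (leqnn n)).
by apply: rank_ge; [apply: indep_up_lo|apply: subsetIr].
Qed.

(** An interval meeting both sides holds at most [hi a - lo s] elements of [I] and [hi t - lo p] of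
    [J]; since [hi a <= lo p], the sum is within [hi t - lo s]. *)
Lemma indep_skewU a p (I J : {set 'I_n}) : a <= p -> p <= n -> hi a <= lo p ->
  I \subset seg n 0 a -> J \subset seg n p n ->
  indep M I -> indep M J -> indep M (I :|: J).
Proof.
move=> leap lepn le sI sJ /indepP iI /indepP iJ; apply/indepP => s t lest.
have := cntU I J s t.
rewrite (cnt_sub_seg s t sI) (cnt_sub_seg s t sJ) max0n.
have [ltas|lesa] := ltnP a s.
  rewrite (@cnt_ge _ I); last by lia.
  have := iJ s t lest; have := @cnt_wide _ J s (maxn p s) t (minn n t).
  by have := @cnt_wide _ J (maxn p s) s (minn n t) t; lia.
have [letp|ltpt] := leqP t p.
  rewrite (@cnt_ge _ J); last by lia.
  have := iI s t lest; have := @cnt_wide _ I s s (minn a t) t.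
  by lia.
have := iI s (minn a t); have := iJ (maxn p s) (minn n t).
have -> : minn a t = a by lia.
have -> : minn n t = t by lia.
have -> : maxn p s = p by lia.
by lia.
Qed.

(* EN corners of the upper path and NE corners of the lower one. *)
Definition hi_corner a :=
  [&& 0 < a, a < n, hi a.-1 == hi a & hi a.+1 == (hi a).+1].

Definition lo_corner p :=
  [&& 0 < p, p < n, lo p == (lo p.-1).+1 & lo p.+1 == lo p].

(** With truncated subtraction the hypothesis says that the point of the upper path after [a] steps
    is not strictly north-west of the point of the lower path after [p] steps: it compares heights
    when [a <= p] and east coordinates otherwise. In the first case the two bases have an
    independent union; in the second the union of the segments is everything and the overlap must
    have rank at least [hi a - lo p]. *)
Lemma segments_modular a p : a <= n -> p <= n -> hi a <= lo p + (a - p) ->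
  rank M (seg n 0 a) + rank M (seg n p n) <=
    rank M (seg n 0 a :|: seg n p n) + rank M (seg n 0 a :&: seg n p n).
Proof.
move=> lea lep le; rewrite rank_prefix // rank_suffix //.
have [leap|ltpa] := leqP a p.
  have e : a - p = 0 by lia.
  rewrite e addn0 in le.
  have : rank M (seg n 0 a :|: seg n p n) >=
      #|(up n hi :&: seg n 0 a) :|: (up n lo :&: seg n p n)|.
    apply: rank_ge; last by apply: setUSS; apply: subsetIr.
    apply: (indep_skewU leap lep le); rewrite ?subsetIr ?indep_up_lo //.
    exact: indep_up_hi.
  set I := up n hi :&: _; set J := up n lo :&: _.
  have -> : #|I :|: J| = #|I| + #|J|.
    by rewrite cardsU [I :&: J](disjoint_setI0 _) ?cards0 ?subn0 //;
      apply/pred0P => x /=; rewrite !inE; lia.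
  by rewrite !card_up //; lia.
(* The path that leaves the lower path at [p], goes north until it hits the upper path and then
   follows it; the hypothesis says that it has arrived there by step [a]. *)
pose h k := minn (lo p + (k - p)) (hi k).
have uh : unit_steps h by move=> k; rewrite /h; have := hi_steps k; lia.
have : rank M (seg n 0 a :|: seg n p n) >= rank M (seg n 0 n).
  by apply: rankS; apply/subsetP => x; rewrite !inE; lia.
rewrite rank_prefix //.
have : rank M (seg n 0 a :&: seg n p n) >= #|up n h :&: seg n p a|.
  apply: rank_ge; last by apply/subsetP => x; rewrite !inE; lia.
  apply: indep_up => // k /andP[lepk leka]; rewrite /h.
  by have := lo_mono lepk; have := lo_le_hi k; lia.
rewrite card_up // /h; have := lo_le_hi p; have := @lo_mono p n.
by lia.
Qed.

(** * Corner prefixes and suffixes as cyclic flats *)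

(** A basis avoiding [x] has at most [hi x] elements before [x] and at most [hi n - lo x.+1] after
    it, and [hi n] in all. *)
Lemma noncoloops_lo_hi (x : 'I_n) : x \in noncoloops M -> lo x.+1 <= hi x.
Proof.
rewrite noncoloopsE => /eqP e.
have [I [/indepP iI sI eI]] := rank_basis M (~: [set x]).
have xI : x \notin I by apply/negP => /(subsetP sI); rewrite !inE eqxx.
have lex := ltn_ord x.
move: eI; rewrite e -seg_full rank_prefix // -cnt0n (@cnt_cat _ _ 0 x); last by lia.
rewrite (@cnt_cat _ _ x x.+1); last by lia.
rewrite cnt_notin //; have := iI 0 x; have := iI x.+1 n.
by lia.
Qed.

Lemma nonloopP (x : 'I_n) : (x \notin loops M) = (lo x < hi x.+1).
Proof.
rewrite loopsE negbK; apply/indepP/idP => h.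
  by have := h x x.+1; rewrite cnt_set1; have := ltn_ord x; lia.
move=> s t lest; rewrite cnt_set1; have := lo_le_hi t; have := @lo_mono s t.
have := @lo_mono s x; have := @hi_mono x.+1 t; have := ltn_ord x.
by lia.
Qed.

Lemma not_closure (X I : {set 'I_n}) (x : 'I_n) :
  rank M X <= #|I| -> I \subset X -> x \notin I -> indep M (x |: I) ->
  x \notin closure M X.
Proof.
move=> le sI xI ixI; rewrite mem_closure; apply/negP => /eqP e.
have := rank_ge ixI (setUS [set x] sI).
by rewrite cardsU1 xI e add1n ltnNge le.
Qed.

(** A nonloop [w] beyond [a] can be added to the north steps of [hi] before [a]: an interval that
    reaches back before [a] contains the north step of [hi] just after [a], which leaves room for
    [w]. *)
Lemma prefix_flat a : hi_corner a -> flat M (core M (seg n 0 a)).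
Proof.
case/and4P => a0 ltan _ /eqP ha; apply: core_flat => w /setIP[_].
rewrite in_setU mem_seg leq0n /=; apply: contraTT; rewrite negb_or -leqNgt.
case/andP => leaw; rewrite nonloopP => wl.
apply: (@not_closure _ (up n hi :&: seg n 0 a)).
- by rewrite rank_prefix ?card_up // ?hi0; lia.
- exact: subsetIr.
- by rewrite !inE; apply/negP; lia.
apply/indepP => s t lest; rewrite cntU1; last by rewrite !inE; apply/negP; lia.
have /indepP/(_ s t lest) := indep_up_hi (ltnW ltan).
have [lesw|//] := boolP (s <= w < t).
rewrite cnt_seg cnt_up ?max0n //; last by lia.
have -> : minn a t = a by lia.
have := @hi_mono s a; have := @hi_mono a.+1 t; have := @lo_mono s w.
by have := @hi_mono w.+1 t; have := @hi_mono a s; have := lo_le_hi s; lia.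
Qed.

Lemma suffix_flat p : lo_corner p -> flat M (core M (seg n p n)).
Proof.
case/and4P => p0 ltpn /eqP lp _; apply: core_flat => w /setIP[_].
rewrite in_setU mem_seg ltn_ord andbT; apply: contraTT; rewrite negb_or -ltnNge.
case/andP => ltwp; rewrite nonloopP => wl.
apply: (@not_closure _ (up n lo :&: seg n p n)).
- by rewrite rank_suffix ?card_up // ?lo_hi_end; lia.
- exact: subsetIr.
- by rewrite !inE; apply/negP; lia.
apply/indepP => s t lest; rewrite cntU1; last by rewrite !inE; apply/negP; lia.
have /indepP/(_ s t lest) := indep_up_lo p.
have [lesw|//] := boolP (s <= w < t).
rewrite cnt_seg cnt_up //; last by lia.
have -> : minn n t = t by lia.
have -> : maxn p s = p by lia.
have := @lo_mono s p.-1; have := @hi_mono w.+1 t; have := @lo_mono s w.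
by have := @lo_mono t p; have := lo_le_hi t; lia.
Qed.

(** For an interval reaching into both segments, the room for one more element between them is the
    strict inequality [hi a < lo p]. *)
Lemma prefix_suffix_flat a p : hi_corner a -> lo_corner p -> hi a < lo p ->
  flat M (core M (seg n 0 a) :|: core M (seg n p n)).
Proof.
case/and4P => a0 ltan _ /eqP ha; case/and4P => p0 ltpn /eqP lp _ ltalp.
have leap : a <= p.
  by rewrite leqNgt; apply/negP => /ltnW/hi_mono; have := lo_le_hi p; lia.
rewrite -coreU; apply: core_flat => w /setIP[_].
rewrite !in_setU !mem_seg ltn_ord andbT; apply: contraTT; rewrite !negb_or -leqNgt.
rewrite -ltnNge => /andP[/andP[leaw ltwp]]; rewrite nonloopP => wl.
have iU := indep_skewU leap (ltnW ltpn) (ltnW ltalp) (subsetIr _ _) (subsetIr _ _)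
  (indep_up_hi (ltnW ltan)) (indep_up_lo p).
apply: (@not_closure _ (up n hi :&: seg n 0 a :|: up n lo :&: seg n p n)).
- apply: leq_trans (_ : hi a + (hi n - lo p) <= _).
    have := rank_submod M (seg n 0 a) (seg n p n).
    by rewrite rank_prefix ?rank_suffix //; lia.
  set I := up n hi :&: _; set J := up n lo :&: _.
  have -> : #|I :|: J| = #|I| + #|J|.
    by rewrite cardsU [I :&: J](disjoint_setI0 _) ?cards0 ?subn0 //;
      apply/pred0P => x /=; rewrite !inE; lia.
  by rewrite !card_up //; lia.
- by apply: setUSS; apply: subsetIr.
- by rewrite !inE; apply/negP; lia.
apply/indepP => s t lest; rewrite cntU1; last by rewrite !inE; apply/negP; lia.
have /indepP/(_ s t lest) := iU.
have [lesw|//] := boolP (s <= w < t) => _.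
have := cntU (up n hi :&: seg n 0 a) (up n lo :&: seg n p n) s t.
rewrite !cnt_seg !cnt_up ?max0n //; try by lia.
have -> : minn n t = t by lia.
have -> : minn a t = a by lia.
have -> : maxn p s = p by lia.
have := @lo_mono s p.-1; have := @hi_mono w.+1 t; have := @lo_mono s w.
have := @lo_mono t p; have := lo_le_hi t.
have := @hi_mono s a; have := @hi_mono a.+1 t; have := @lo_mono p t.
have := @hi_mono a s; have := lo_le_hi s.
by lia.
Qed.

Lemma prefix_cyclic a : hi_corner a -> cyclic M (core M (seg n 0 a)).
Proof.
case/and4P => a0 ltan /eqP ea _; apply: core_cyclic => x.
rewrite inE mem_seg /= => /andP[ltxa /noncoloops_lo_hi xc].
have exE : exists y, (x <= y) && (hi y.+1 == hi y).
  by exists a.-1; rewrite prednK // ea eqxx andbT; lia.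
case: (ex_minnP exE) => y /andP[lexy /eqP ey] miny.
have ltya : y < a.
  have := miny a.-1; rewrite prednK // ea eqxx andbT; lia.
have run k : x <= k <= y -> hi k = hi x + (k - x).
  elim: k => [|k IHk] lek; first by (have -> : nat_of_ord x = 0 by lia); rewrite addn0.
  have [ek|lexk] := eqVneq k.+1 (x : nat); first by rewrite ek subnn addn0.
  have := IHk; have := hi_steps k; have := miny k.
  by case: eqP; lia.
(* [y] is the first east step of [hi] from [x] on, and it exists because [a.-1] is one. Lowering
   [hi] by one between [x] and [y] makes step [x] east and step [y] north, so the path avoids [x]
   without losing height at [a]. It stays above [lo] because [lo x.+1 <= hi x]. *)
pose h k := hi k - (x < k <= y).
have uh : unit_steps h.
  move=> k; have := hi_steps k; rewrite /h.
  have [ek|nek] := eqVneq k (x : nat).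
    subst k; have [e|nexy] := eqVneq y (x : nat); first by lia.
    by have := run x.+1; lia.
  have [->|neky] := eqVneq k y; last by have := run k; lia.
  by have := run y; rewrite ey; lia.
have uE : x \notin up n h.
  rewrite inE /h ltnn /=; have [e|nexy] := eqVneq y (x : nat).
    by rewrite -e ey; lia.
  by have := run x.+1; lia.
have : #|up n h :&: seg n 0 a| <= rank M (seg n 0 a :\ x).
  apply: rank_ge; last by rewrite subsetD1 subsetIr inE (negPf uE).
  apply: indep_up => // [|k lek]; first by lia.
  rewrite /h; have := lo_le_hi k; have := @lo_mono x.+1 k; have := run k.
  by lia.
rewrite card_up ?(ltnW ltan) // /h => le; rewrite mem_closure setD1K ?mem_seg //.
have := rankS M (subsetDl (seg n 0 a) [set x]); rewrite eqn_leq andbC => -> /=.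
by rewrite rank_prefix ?(ltnW ltan) //; apply: leq_trans le; lia.
Qed.

(** Mirror image of the prefix case: [y] is the last east step of [lo] up to [x], at or after the
    east step at [p], and [lo] is raised by one between [y] and [x]. *)
Lemma suffix_cyclic p : lo_corner p -> cyclic M (core M (seg n p n)).
Proof.
case/and4P => p0 ltpn _ /eqP ep; apply: core_cyclic => x.
rewrite inE mem_seg ltn_ord andbT => /andP[lepx /noncoloops_lo_hi xc].
have exE : exists y, (y <= x) && (lo y.+1 == lo y) by exists p; rewrite ep eqxx lepx.
have bE y : (y <= x) && (lo y.+1 == lo y) -> y <= x by case/andP.
case: (ex_maxnP exE bE) => y /andP[leyx /eqP ey] maxy.
have lepy : p <= y by apply: maxy; rewrite ep eqxx lepx.
have ltxn := ltn_ord x.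
have run k : y < k <= x.+1 -> lo k = lo y + (k - y.+1).
  elim: k => [|k IHk] lek; first by lia.
  have [ek|nek] := eqVneq k y; first by rewrite ek ey subnn addn0.
  have := IHk; have := lo_steps k; have := maxy k.
  by case: eqP; lia.
pose h k := lo k + (y < k <= x).
have uh : unit_steps h.
  move=> k; have := lo_steps k; rewrite /h.
  have [->|neky] := eqVneq k y; first by rewrite ey; lia.
  have [->|nekx] := eqVneq k x; last by lia.
  by have [e|nexy] := eqVneq y (x : nat); [lia|have := run x; have := run x.+1; lia].
have uE : x \notin up n h.
  rewrite inE /h; have [e|nexy] := eqVneq y (x : nat).
    by rewrite -e ey; lia.
  by have := run x; have := run x.+1; lia.
have : #|up n h :&: seg n p n| <= rank M (seg n p n :\ x).
  apply: rank_ge; last by rewrite subsetD1 subsetIr inE (negPf uE).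
  apply: indep_up => // k lek.
  rewrite /h; have := lo_le_hi k; have := @hi_mono k x; have := run k.
  by have := run x.+1; lia.
rewrite card_up // /h => le; rewrite mem_closure setD1K ?mem_seg ?lepx //.
have := rankS M (subsetDl (seg n p n) [set x]); rewrite eqn_leq andbC => -> /=.
by rewrite rank_suffix ?(ltnW ltpn) //; apply: leq_trans le; rewrite lo_hi_end; lia.
Qed.

(** * Corners that cut an element off a cyclic flat *)

(** An interval violating the criterion for [x |: I] must contain [x], and since [I] itself
    satisfies the criterion the excess is exactly one. *)
Lemma tight_interval (I : {set 'I_n}) (x : 'I_n) :
  indep M I -> x \notin I -> ~~ indep M (x |: I) ->
  exists s t, [/\ s <= x < t, t <= n & cnt I s t + lo s = hi t].
Proof.
move=> /indepP iI xI dxI.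
have [/existsP[s /existsP[t /andP[lest lt]]]|noex] := boolP [exists s : 'I_n.+1,
    [exists t : 'I_n.+1, (s <= t) && (hi t < cnt (x |: I) s t + lo s)]].
  have letn : t <= n by rewrite -ltnS.
  exists s, t; move: lt (iI s t); rewrite cntU1 // lest letn => lt /(_ isT).
  by case: (boolP (s <= x < t)) lt => h lt le; split=> //; lia.
case/negP: dxI; apply/indepP => s t /andP[lest letn]; rewrite leqNgt.
apply: contra noex => lt.
have ltsn : s < n.+1 by lia.
have lttn : t < n.+1 by lia.
apply/existsP; exists (Ordinal ltsn); apply/existsP; exists (Ordinal lttn).
by rewrite lest.
Qed.

(** A basis of [F :\ x] is a basis of [F] because [F] is cyclic; flatness lets [z] be added to it,
    and [x] cannot be. *)
Lemma cyclic_basis (F : {set 'I_n}) (z x : 'I_n) :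
  F \in cyclic_flats M -> z \notin F -> x \in F ->
  exists I : {set 'I_n}, [/\ I \subset F :\ x, indep M I,
    indep M (z |: I) & ~~ indep M (x |: I)].
Proof.
move=> zF zn xF.
have [cF fF] : cyclic M F /\ flat M F by apply/andP; rewrite -in_cyclic_flats.
have [I [iI sI eI]] := rank_basis M (F :\ x).
have xI : x \notin I by apply/negP => /(subsetP sI); rewrite !inE eqxx.
have sIF : I \subset F by apply: subset_trans sI (subsetDl _ _).
have zI : z \notin I by apply: contra zn; apply/subsetP.
rewrite (cyclicP _ _ cF) // in eI; exists I; split=> //.
  apply: indep_rank; rewrite cardsU1 zI add1n -(rank_indep iI) ltn_neqAle.
  rewrite rankS ?subsetUr // andbT eq_sym -mem_closure.
  apply: contra zn => /(subsetP (closureS M sIF)).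
  by rewrite (cyclic_flat_closed zF).
have sxIF : x |: I \subset F by rewrite subUset sub1set xF.
by apply/negP => /rank_ge/(_ sxIF); rewrite cardsU1 xI eI ltnn.
Qed.

Lemma indep_nonloop (I : {set 'I_n}) (y : 'I_n) :
  indep M I -> y \in I -> y \notin loops M.
Proof.
by move=> iI yI; rewrite loopsE negbK; apply: indep_sub iI; rewrite sub1set.
Qed.

(* a is the right end of an interval that is tight for a basis of F avoiding
   the last nonloop of F before z, pushed right along the east steps of hi. *)
Lemma left_corner (F : {set 'I_n}) (z x : 'I_n) :
  F \in cyclic_flats M -> z \notin F -> x \in F -> x \notin loops M -> x < z ->
  exists a s (I : {set 'I_n}),
    [/\ [/\ hi_corner a, a <= z & s <= a],
        forall y : 'I_n, y \in F -> y \notin loops M -> y < z -> y < a,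
        I \subset F :&: seg n s a, indep M I & #|I| + lo s = hi a].
Proof.
move=> zF zn; pose P (x : 'I_n) := [&& x \in F, x \notin loops M & x < z].
move=> xF xl ltxz; have Px : P x by rewrite /P xF xl.
case: (arg_maxnP (fun y : 'I_n => y : nat) Px) => {x xF xl ltxz Px} x.
case/and3P => xF xl ltxz maxx.
have [I [sI iI izI dxI]] := cyclic_basis zF zn xF.
have xI : x \notin I by apply/negP => /(subsetP sI); rewrite !inE eqxx.
have sIF : I \subset F by apply: subset_trans sI (subsetDl _ _).
have zI : z \notin I by apply: contra zn; apply/subsetP.
have [s [t [/andP[lesx ltxt] letn eI]]] := tight_interval iI xI dxI.
have iIP := indepP _ iI; have izIP := indepP _ izI.
have lest : s <= t <= n by rewrite letn (leq_trans lesx (ltnW ltxt)).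
(* A tight interval cannot contain [z], since [z |: I] is independent. *)
have letz : t <= z.
  have [//|ltzt] := leqP t z; have := izIP s t lest.
  have -> := cntU1 s t zI; have -> : s <= z < t by clear -lesx ltxz ltzt; lia.
  by rewrite -addnA eI add1n ltnn.
have cI0 : cnt I x.+1 t = 0.
  apply/eqP; rewrite cards_eq0; apply/eqP/setP => y; rewrite in_setI mem_seg in_set0.
  apply/negP => /andP[yI le].
  have leyx : y <= x.
    apply: maxx; rewrite /P (subsetP sIF) // (indep_nonloop iI yI) /=.
    by clear -le letz; lia.
  by clear -le leyx; lia.
(* By maximality of [x] no element of [I] follows it in the interval, so the part ending at [x]
   already holds [hi t - lo s] elements. *)
have ext : hi t = hi x.
  have lesxn : s <= x <= n by rewrite lesx ltnW.
  have := iIP s x lesxn; have := hi_mono (ltnW ltxt); move: eI.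
  have -> : cnt I s t = cnt I s x.
    rewrite (@cnt_cat _ _ s x) ?(@cnt_cat _ _ x x.+1 t) ?leqnSn ?ltxt ?lesx
      ?(ltnW ltxt) //.
    by rewrite cI0 cnt_notin // !addn0.
  by clear; lia.
have exE : exists k, (k <= z) && (hi k == hi x) by exists t; rewrite letz ext eqxx.
have bE k : (k <= z) && (hi k == hi x) -> k <= z by case/andP.
case: (ex_maxnP exE bE) => a /andP[leaz /eqP ea] maxa.
have leta : t <= a by apply: maxa; rewrite letz ext eqxx.
have ltxa : x < a := leq_trans ltxt leta.
exists a, s, (I :&: seg n s t); split.
- split=> //; last by rewrite (leq_trans lesx) // ltnW.
  apply/and4P; split.
  + exact: leq_ltn_trans ltxa.
  + exact: leq_ltn_trans leaz (ltn_ord z).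
  + have := @hi_mono x a.-1; have := hi_mono (leq_pred a); rewrite ea.
    by clear -ltxa; lia.
  (* A north step follows [a]: before [z] by maximality of [a]; at [z] because [z |: I] is
     independent and has at least one element more than the tight count between [s] and [z.+1]. *)
  have := hi_steps a; have [eaz|neaz] := eqVneq a z.
    have lesz : s <= z.+1 <= n.
      by rewrite ltn_ord andbT; apply: leq_trans lesx _; rewrite leqW // ltnW.
    have := izIP s z.+1 lesz; have -> := cntU1 s z.+1 zI.
    have -> : s <= z < z.+1 by rewrite ltnSn andbT (leq_trans lesx) // ltnW.
    have := @cnt_wide _ I s s t z.+1 (leqnn s) (leqW letz).
    by rewrite -eaz; move: eI; rewrite ext -ea; clear; lia.
  have := maxa a.+1; rewrite ltnNge eq_sym; move: leaz neaz; rewrite ea.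
  by clear; case: eqP; lia.
- move=> y yF yl ltyz; apply: leq_ltn_trans ltxa.
  by apply: maxx; rewrite /P yF yl ltyz.
- rewrite subsetI subIset ?sIF //=; apply/subsetP => y; rewrite !inE.
  by case/and3P=> _ -> /leq_trans; apply.
- by apply: indep_sub iI; apply: subsetIl.
- by rewrite -/(cnt I s t) eI ea.
Qed.

(** Mirror image: [x] is the first nonloop of [F] after [z], and [p] is the left end of a tight
    interval, pushed left along the east steps of [lo]. *)
Lemma right_corner (F : {set 'I_n}) (z x : 'I_n) :
  F \in cyclic_flats M -> z \notin F -> x \in F -> x \notin loops M -> z < x ->
  exists p t (I : {set 'I_n}),
    [/\ [/\ lo_corner p, z < p & p <= t <= n],
        forall y : 'I_n, y \in F -> y \notin loops M -> z < y -> p <= y,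
        I \subset F :&: seg n p t, indep M I & #|I| + lo p = hi t].
Proof.
move=> zF zn; pose P (x : 'I_n) := [&& x \in F, x \notin loops M & z < x].
move=> xF xl ltzx; have Px : P x by rewrite /P xF xl.
case: (arg_minnP (fun y : 'I_n => y : nat) Px) => {x xF xl ltzx Px} x.
case/and3P => xF xl ltzx minx.
have [I [sI iI izI dxI]] := cyclic_basis zF zn xF.
have xI : x \notin I by apply/negP => /(subsetP sI); rewrite !inE eqxx.
have sIF : I \subset F by apply: subset_trans sI (subsetDl _ _).
have zI : z \notin I by apply: contra zn; apply/subsetP.
have [s [t [/andP[lesx ltxt] letn eI]]] := tight_interval iI xI dxI.
have iIP := indepP _ iI; have izIP := indepP _ izI.
have lest : s <= t <= n by rewrite letn (leq_trans lesx (ltnW ltxt)).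
have ltzs : z < s.
  have [//|lesz] := ltnP z s; have := izIP s t lest.
  have -> := cntU1 s t zI.
  have -> : s <= z < t by rewrite lesz (ltn_trans ltzx ltxt).
  by rewrite -addnA eI add1n ltnn.
have cI0 : cnt I s x = 0.
  apply/eqP; rewrite cards_eq0; apply/eqP/setP => y; rewrite in_setI mem_seg in_set0.
  apply/negP => /andP[yI /andP[lesy ltyx]].
  suff : x <= y by rewrite leqNgt ltyx.
  apply: minx; rewrite /P (subsetP sIF) // (indep_nonloop iI yI) /=.
  exact: leq_trans ltzs lesy.
have cIt : cnt I s t = cnt I x.+1 t.
  rewrite (@cnt_cat _ _ s x) ?(@cnt_cat _ _ x x.+1 t) ?leqnSn ?ltxt ?lesx
    ?(ltnW ltxt) //.
  by rewrite cI0 cnt_notin.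
have esx : lo s = lo x.+1.
  have lext : x < t <= n by rewrite ltxt.
  have := iIP x.+1 t lext; have := lo_mono (leqW lesx); move: eI; rewrite cIt.
  by clear; lia.
have exE : exists k, (z < k) && (lo k == lo x.+1) by exists s; rewrite ltzs esx eqxx.
case: (ex_minnP exE) => p /andP[ltzp /eqP ep] minp.
have leps : p <= s by apply: minp; rewrite ltzs esx eqxx.
have lepx : p <= x := leq_trans leps lesx.
exists p, t, (I :&: seg n s t); split.
- split=> //; last by rewrite letn (leq_trans lepx) // ltnW.
  apply/and4P; split.
  + exact: leq_ltn_trans ltzp.
  + exact: leq_ltn_trans lepx (ltn_ord x).
  + have := lo_steps p.-1; rewrite prednK ?(leq_ltn_trans _ ltzp) //.
    have [ezp|nezp] := eqVneq p.-1 z.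
      have lezt : z <= t <= n by rewrite letn ltnW // (ltn_trans ltzx).
      have := izIP z t lezt; have -> := cntU1 z t zI.
      have -> : z <= z < t by rewrite leqnn (ltn_trans ltzx).
      have := @cnt_wide _ I s z t t (ltnW ltzs) (leqnn t).
      by rewrite ezp; move: eI; rewrite esx -ep; clear; lia.
    have := minp p.-1; move: nezp ltzp; rewrite ep.
    by clear; case: eqP; lia.
  have := @lo_mono p p.+1; have := @lo_mono p.+1 x.+1; rewrite ep.
  by clear -lepx; lia.
- move=> y yF yl ltzy; apply: leq_trans lepx _.
  by apply: minx; rewrite /P yF yl ltzy.
- rewrite subsetI subIset ?sIF //=; apply/subsetP => y; rewrite !inE.
  by case/and3P=> _ /(leq_trans leps) -> ->.
- by apply: indep_sub iI; apply: subsetIl.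
- by rewrite -/(cnt I s t) ep -esx eI.
Qed.

(** * Connected components and the converse of modularity *)

(** The interval from [c] to [y.+1] is overfull by one. After an element [w] is removed, an interval
    around [z] either contains [w], and [z] takes its place, or starts strictly after [c], where the
    gap [lo s < hi s] leaves room for [z]. *)
Lemma fundamental_circuit c y :
  c < y < n -> lo c = hi c -> hi c < hi c.+1 -> hi y.+1 = hi y ->
  (forall k, c < k <= y -> lo k < hi k) ->
  forall z : 'I_n, z = y :> nat -> circuit M (z |: (up n hi :&: seg n c y)).
Proof.
move=> /andP[ltcy ltyn] ec upc ey gap z ez; set I := up n hi :&: _.
have iI : indep M I.
  by apply: indep_up => [//||k _]; [apply: ltnW|rewrite lo_le_hi /=].
have zI : z \notin I by rewrite in_setI mem_seg ez ltnn !andbF.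
apply/circuitP; split=> [|w].
  apply/negP => /indepP/(_ c y.+1); rewrite cntU1 // ez cnt_seg cnt_up //; last by lia.
  have -> : maxn c c = c by lia.
  have -> : minn y y.+1 = y by lia.
  by have := @hi_mono c y; lia.
rewrite in_setU1; have [-> _|nwz /= wI] := eqVneq w z; first by rewrite setU1K.
have zIw : z \notin I :\ w by rewrite in_setD1 (negPf zI) andbF.
have wI' : w \notin I :\ w by rewrite in_setD1 eqxx.
have -> : (z |: I) :\ w = z |: (I :\ w).
  by apply/setP => v; rewrite !in_setD1 !in_setU1 in_setD1;
    case: (eqVneq v z) => [->|] //; rewrite eq_sym nwz.
have /indepP iIw : indep M (I :\ w) by apply: indep_sub iI; apply: subsetDl.
apply/indepP => s t lest; rewrite cntU1 //.
have [lesz|_] := boolP (s <= z < t); last exact: iIw.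
have [lesw|ltws] := leqP s w.
  have := (indepP _ iI) s t lest.
  have -> : cnt I s t = (s <= w < t) + cnt (I :\ w) s t by rewrite -cntU1 // setD1K.
  suff -> : s <= w < t by [].
  move: wI; rewrite in_setI mem_seg => /andP[_ /andP[_ ltwy]].
  by move: lesz; rewrite lesw -ez in ltwy * => /andP[_ /(ltn_trans ltwy)].
have ltcw : c <= w by move: wI; rewrite in_setI mem_seg => /and3P[].
have gs : lo s < hi s.
  by apply: gap; rewrite (leq_ltn_trans ltcw ltws) -ez; case/andP: lesz.
have := @cntS _ (I :\ w) I s t (subsetDl _ _).
rewrite cnt_seg cnt_up //; last by lia.
have -> : maxn c s = s by lia.
have -> : minn y t = y by lia.
have := @hi_mono s y; have := @hi_mono y t.
by clear -gs lesz ez; lia.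
Qed.

(** Each element shares a circuit with the first one: an east step of [hi] through its own
    fundamental circuit, a north step through that of the last step, which is east because [hi]
    comes down to [lo] at [d]. Conversely, a circuit leaving the segment would be cut by [c] and [d]
    into three independent pieces, and their union is independent because the paths meet at these
    points. *)
Lemma common_segment_component c d :
  c.+1 < d <= n -> lo c = hi c -> lo d = hi d ->
  (forall k, c < k < d -> lo k < hi k) -> connected_component M (seg n c d).
Proof.
move=> /andP[ltcd ledn] ec ed gap.
have ltcn : c < n by lia.
have ltdn : d.-1 < n by lia.
have upc : hi c < hi c.+1 by have := gap c.+1; have := @lo_mono c c.+1; lia.
have eastd : hi d.-1.+1 = hi d.-1.
  rewrite prednK; last by lia.
  by have := gap d.-1; have := @lo_mono d.-1 d; have := @hi_mono d.-1 d; lia.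
pose x := Ordinal ltcn; exists x; apply/setP => y; rewrite mem_seg inE.
have fc (z : 'I_n) : c < z < d -> hi z.+1 = hi z ->
    circuit M (z |: (up n hi :&: seg n c z)).
  move=> lez ez; apply: (fundamental_circuit _ ec upc ez) => //.
    by rewrite ltn_ord andbT; case/andP: lez.
  by move=> k lek; apply: gap; lia.
have memx (z : 'I_n) : c < z -> x \in z |: (up n hi :&: seg n c z).
  by move=> ltcz; rewrite in_setU1 in_setI inE mem_seg /= upc leqnn ltcz orbT.
apply/idP/idP => [/andP[lecy ltyd]|].
  have [//|nyx /=] := eqVneq y x.
  have ltcy : c < y.
    rewrite ltn_neqAle lecy andbT eq_sym; apply: contra nyx => /eqP e.
    by apply/eqP/val_inj.
  apply/existsP; have [uy|ey] := ltnP (hi y) (hi y.+1).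
    exists (Ordinal ltdn |: (up n hi :&: seg n c d.-1)); apply/and3P; split.
    - by apply: fc => //=; lia.
    - by apply: memx => /=; lia.
    - rewrite in_setU1 in_setI inE uy mem_seg lecy /=.
      suff -> : y < d.-1 by rewrite orbT.
      have : y <> d.-1 :> nat by move=> e; move: uy; rewrite e eastd ltnn.
      by clear -ltyd; lia.
  exists (y |: (up n hi :&: seg n c y)); rewrite setU11 memx // andbT.
  rewrite fc ?ltcy //; have := hi_steps y; clear -ey; lia.
case/orP => [/eqP->|/existsP[C /and3P[/circuitP[dC iC] xC yC]]].
  by rewrite /= leqnn (ltn_trans _ ltcd).
apply: contraR dC => yX.
have i1 : indep M (C :&: seg n c d).
  apply: indep_sub (iC y yC); rewrite subsetD1 subsetIl in_setI mem_seg.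
  by rewrite (negPf yX) andbF.
have i0 : indep M (C :&: seg n 0 c).
  apply: indep_sub (iC x xC); rewrite subsetD1 subsetIl in_setI mem_seg /=.
  by rewrite ltnn !andbF.
have i2 : indep M (C :&: seg n d n).
  apply: indep_sub (iC x xC); rewrite subsetD1 subsetIl in_setI mem_seg /=.
  by rewrite [d <= c]leqNgt (ltn_trans _ ltcd) // andbF.
have lecd : c <= d by lia.
have := indep_skewU (leqnn d) ledn (eq_leq (esym ed)) _ (subsetIr _ _) _ i2.
move/(_ (C :&: seg n 0 c :|: C :&: seg n c d)).
have -> : C :&: seg n 0 c :|: C :&: seg n c d :|: C :&: seg n d n = C.
  apply/setP => v; rewrite !in_setU !in_setI !mem_seg ltn_ord andbT /=.
  by case: (v \in C) => //=; clear -lecd; lia.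
apply.
  by apply/subsetP => v; rewrite in_setU !in_setI !mem_seg /=; clear -lecd; lia.
apply: (indep_skewU (leqnn c) (ltnW ltcn) (eq_leq (esym ec)) (subsetIr _ _)) => //.
by apply/subsetP => v; rewrite in_setI !mem_seg ltn_ord andbT => /and3P[].
Qed.

(** Pure bookkeeping of four estimates: the ranks are at least [hi a - hi c] and [lo d - lo p], the
    union has rank at most [hi d - lo c], and the overlap has at most [a - p] elements. *)
Lemma segments_modular_bound c d a p :
  c <= a <= d -> c <= p <= d -> d <= n -> lo c = hi c -> lo d = hi d ->
  rank M (seg n c a) + rank M (seg n p d) <=
    rank M (seg n c a :|: seg n p d) + rank M (seg n c a :&: seg n p d) ->
  hi a <= lo p + (a - p).
Proof.
move=> /andP[leca lead] /andP[lecp lepd] ledn ec ed.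
have : hi a - hi c <= rank M (seg n c a).
  rewrite -(card_up c hi_steps (leq_trans lead ledn)).
  apply: rank_ge (subsetIr _ _); apply: indep_up => [//||k _]; last first.
    by rewrite lo_le_hi /=.
  exact: leq_trans ledn.
have : lo d - lo p <= rank M (seg n p d).
  rewrite -(card_up p lo_steps ledn).
  apply: rank_ge (subsetIr _ _); apply: indep_up => // k _.
  by rewrite lo_le_hi leqnn.
have : rank M (seg n c a :|: seg n p d) + lo c <= hi d.
  apply: rank_sub_seg; first by rewrite ledn (leq_trans leca).
  by apply/subsetP => x; rewrite in_setU !mem_seg; clear -lead lecp; lia.
have : rank M (seg n c a :&: seg n p d) <= a - p.
  apply: leq_trans (rank_le_card _ _) _; rewrite -(card_seg p (leq_trans lead ledn)).
  apply/subset_leq_card/subsetP => x; rewrite in_setI !mem_seg; clear; lia.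
have := lo_mono lepd; have := hi_mono leca; move: ec ed; clear; lia.
Qed.

(** * The two chains and the cyclic flats they generate *)

Hypothesis corners_comparable :
  forall a p, hi_corner a -> lo_corner p -> hi a <= lo p + (a - p).

(* If hi a = lo p then I and J together would span an interval around z. *)
Lemma corner_gap (F : {set 'I_n}) (z : 'I_n) a p s t (I J : {set 'I_n}) :
  F \in cyclic_flats M -> z \notin F ->
  hi_corner a -> lo_corner p -> a <= z < p -> s <= a -> p <= t <= n ->
  I \subset F :&: seg n s a -> indep M I -> #|I| + lo s = hi a ->
  J \subset F :&: seg n p t -> indep M J -> #|J| + lo p = hi t ->
  hi a < lo p.
Proof.
move=> zF zn ca cp /andP[leaz ltzp] lesa /andP[lept letn] sI iI eI sJ iJ eJ.
have leap : a <= p by apply: leq_trans leaz (ltnW ltzp).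
have lepn : p <= n by case/and4P: cp => _ /ltnW.
have leh : hi a <= lo p.
  have := corners_comparable ca cp; rewrite (_ : a - p = 0) ?addn0 //.
  exact/eqP.
rewrite ltn_neqAle leh andbT; apply/negP => /eqP eh.
have [sIF sIa] : I \subset F /\ I \subset seg n s a by apply/andP; rewrite -subsetI.
have [sJF sJp] : J \subset F /\ J \subset seg n p t by apply/andP; rewrite -subsetI.
have iIJ : indep M (I :|: J).
  apply: (indep_skewU leap lepn leh) => //.
    by apply: (subset_trans sIa); apply/subsetP => x; rewrite !inE => /andP[].
  apply: (subset_trans sJp); apply/subsetP => x; rewrite !inE ltn_ord andbT.
  by case/andP.
have dIJ : [disjoint I & J].
  rewrite disjoint_subset; apply/subsetP => x /(subsetP sIa).
  rewrite mem_seg => /andP[_ ltxa]; rewrite inE; apply/negP => /(subsetP sJp).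
  rewrite mem_seg => /andP[lepx _].
  by have := leq_ltn_trans lepx ltxa; rewrite ltnNge leap.
have zIJ : z \notin I :|: J.
  by apply: contra zn; rewrite inE => /orP[/(subsetP sIF)|/(subsetP sJF)].
have : z \in closure M F.
  apply: (subsetP (closureS M (_ : I :|: J \subset F))); first by rewrite subUset sIF.
  rewrite mem_closure eqn_leq [X in _ && X]rankS ?subsetUr // andbT.
  rewrite (rank_indep iIJ) cardsU disjoint_setI0 // cards0 subn0.
  have sub : z |: (I :|: J) \subset seg n s t.
    apply/subsetP => x; rewrite !in_setU in_set1 mem_seg => /or3P[/eqP->||].
    - by rewrite (leq_trans lesa leaz) (leq_trans ltzp lept).
    - move/(subsetP sIa); rewrite mem_seg => /andP[-> ltxa].
      exact: leq_trans ltxa (leq_trans leap lept).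
    - move/(subsetP sJp); rewrite mem_seg => /andP[lepx ->]; rewrite andbT.
      exact: leq_trans lesa (leq_trans leap lepx).
  have lest : s <= t <= n by rewrite letn andbT (leq_trans lesa) ?(leq_trans leap).
  have := rank_sub_seg lest sub.
  by rewrite -eJ -eh -eI addnA leq_add2r addnC.
by rewrite (cyclic_flat_closed zF) (negPf zn).
Qed.

(** The loops and the noncoloops are the cores of the empty and of the full prefix. *)
Definition prefix_flats : {set {set 'I_n}} :=
  loops M |: (noncoloops M |: [set core M (seg n 0 a) | a : 'I_n & hi_corner a]).

Definition suffix_flats : {set {set 'I_n}} :=
  loops M |: (noncoloops M |: [set core M (seg n p n) | p : 'I_n & lo_corner p]).

Lemma prefix_flatsP A : A \in prefix_flats ->
  [\/ A = loops M, A = noncoloops M |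
      exists2 a, hi_corner a & A = core M (seg n 0 a)].
Proof.
rewrite !in_setU !in_set1 => /or3P[/eqP|/eqP|/imsetP[a]]; first by constructor 1.
  by constructor 2.
by rewrite inE => ca ->; constructor 3; exists a.
Qed.

Lemma suffix_flatsP B : B \in suffix_flats ->
  [\/ B = loops M, B = noncoloops M |
      exists2 p, lo_corner p & B = core M (seg n p n)].
Proof.
rewrite !in_setU !in_set1 => /or3P[/eqP|/eqP|/imsetP[a]]; first by constructor 1.
  by constructor 2.
by rewrite inE => ca ->; constructor 3; exists a.
Qed.

Lemma mem_prefix_flats a : hi_corner a -> core M (seg n 0 a) \in prefix_flats.
Proof.
move=> ca; have /and4P[_ ltan _ _] := ca; rewrite !in_setU; apply/or3P.
by constructor 3; apply/imsetP; exists (Ordinal ltan); rewrite ?inE.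
Qed.

Lemma mem_suffix_flats p : lo_corner p -> core M (seg n p n) \in suffix_flats.
Proof.
move=> cp; have /and4P[_ ltpn _ _] := cp; rewrite !in_setU; apply/or3P.
by constructor 3; apply/imsetP; exists (Ordinal ltpn); rewrite ?inE.
Qed.

Lemma prefix_cyclic_flats : prefix_flats \subset cyclic_flats M.
Proof.
apply/subsetP => A /prefix_flatsP[->|->|[a ca ->]].
- exact: loops_cyclic_flat.
- exact: noncoloops_cyclic_flat.
- by rewrite in_cyclic_flats prefix_cyclic ?prefix_flat.
Qed.

Lemma suffix_cyclic_flats : suffix_flats \subset cyclic_flats M.
Proof.
apply/subsetP => A /suffix_flatsP[->|->|[a ca ->]].
- exact: loops_cyclic_flat.
- exact: noncoloops_cyclic_flat.
- by rewrite in_cyclic_flats suffix_cyclic ?suffix_flat.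
Qed.

Lemma cyclic_flat_bounds F :
  F \in cyclic_flats M -> loops M \subset F /\ F \subset noncoloops M.
Proof.
move=> zF; split; first exact: loops_sub.
by move: zF; rewrite in_cyclic_flats => /andP[/sub_noncoloops].
Qed.

Lemma prefix_flats_chain :
  {in prefix_flats &, forall A A' : {set 'I_n}, (A \subset A') || (A' \subset A)}.
Proof.
move=> A A' mA mA'; have zA := subsetP prefix_cyclic_flats _ mA.
have zA' := subsetP prefix_cyclic_flats _ mA'.
have [lA hA] := cyclic_flat_bounds zA; have [lA' hA'] := cyclic_flat_bounds zA'.
case/prefix_flatsP: mA => [eA|eA|[a _ eA]]; rewrite ?eA ?lA' ?hA' ?orbT //.
case/prefix_flatsP: mA' => [eA'|eA'|[a' _ eA']]; rewrite ?eA' -?eA ?lA ?hA ?orbT //.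
by rewrite eA; case: (leqP a a') => le; apply/orP; [left|right]; apply: coreS;
  apply/subsetP => x; rewrite !mem_seg => /leq_trans; apply; rewrite // ltnW.
Qed.

Lemma suffix_flats_chain :
  {in suffix_flats &, forall A A' : {set 'I_n}, (A \subset A') || (A' \subset A)}.
Proof.
move=> A A' mA mA'; have zA := subsetP suffix_cyclic_flats _ mA.
have zA' := subsetP suffix_cyclic_flats _ mA'.
have [lA hA] := cyclic_flat_bounds zA; have [lA' hA'] := cyclic_flat_bounds zA'.
case/suffix_flatsP: mA => [eA|eA|[a _ eA]]; rewrite ?eA ?lA' ?hA' ?orbT //.
case/suffix_flatsP: mA' => [eA'|eA'|[a' _ eA']]; rewrite ?eA' -?eA ?lA ?hA ?orbT //.
by rewrite eA; case: (leqP a a') => le; apply/orP; [right|left]; apply: coreS;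
  apply/subsetP => x; rewrite !mem_seg !ltn_ord !andbT; apply: leq_trans;
  rewrite // ltnW.
Qed.

Lemma modular_sub (A B : {set 'I_n}) : A \subset B ->
  rank M A + rank M B <= rank M (A :|: B) + rank M (A :&: B).
Proof. by move=> sAB; rewrite (setUidPr sAB) (setIidPl sAB) addnC. Qed.

Lemma prefix_suffix_modular A B : A \in prefix_flats -> B \in suffix_flats ->
  rank M A + rank M B <= rank M (A :|: B) + rank M (A :&: B).
Proof.
move=> mA mB; have zA := subsetP prefix_cyclic_flats _ mA.
have zB := subsetP suffix_cyclic_flats _ mB.
have [lA hA] := cyclic_flat_bounds zA; have [lB hB] := cyclic_flat_bounds zB.
case/prefix_flatsP: mA => [eA|eA|[a ca eA]].
- by rewrite eA modular_sub.
- by rewrite eA addnC setUC setIC modular_sub.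
case/suffix_flatsP: mB => [eB|eB|[p cp eB]].
- by rewrite eB addnC setUC setIC modular_sub.
- by rewrite eB modular_sub.
rewrite eA eB; apply: core_modular; apply: segments_modular.
- by case/and4P: ca => _ /ltnW.
- by case/and4P: cp => _ /ltnW.
- exact: corners_comparable.
Qed.

Lemma prefix_suffix_cover A B : A \in prefix_flats -> B \in suffix_flats ->
  A :&: B = loops M \/ A :|: B = noncoloops M.
Proof.
move=> mA mB; have zA := subsetP prefix_cyclic_flats _ mA.
have zB := subsetP suffix_cyclic_flats _ mB.
have [lA hA] := cyclic_flat_bounds zA; have [lB hB] := cyclic_flat_bounds zB.
case/prefix_flatsP: mA => [eA|eA|[a _ eA]].
- by left; rewrite eA (setIidPl lB).
- by right; rewrite eA (setUidPl hB).
case/suffix_flatsP: mB => [eB|eB|[p _ eB]].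
- by left; rewrite eB (setIidPr lA).
- by right; rewrite eB (setUidPr hA).
rewrite eA eB -coreI -coreU -core0 -coreT; have [leap|ltpa] := leqP a p.
  left; congr core; apply/setP => x; rewrite !inE; apply/negP.
  case/andP => /= ltxa /andP[lepx _].
  by have := leq_ltn_trans lepx ltxa; rewrite ltnNge leap.
right; congr core; apply/setP => x; rewrite !inE ltn_ord andbT /=.
by case: (leqP p x) => [|ltxp]; rewrite ?orbT // (ltn_trans ltxp).
Qed.

Lemma sub_core (F X : {set 'I_n}) : F \in cyclic_flats M ->
  (forall y, y \in F -> y \notin loops M -> y \in X) -> F \subset core M X.
Proof.
move=> zF h; apply/subsetP => y yF; rewrite in_setU in_setI.
have [//|yl] := boolP (y \in loops M); first by rewrite orbT.
by rewrite h //= (subsetP (cyclic_flat_bounds zF).2).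
Qed.

Lemma notin_core (z : 'I_n) (X : {set 'I_n}) :
  z \notin loops M -> z \notin X -> z \notin core M X.
Proof. by move=> zl zX; rewrite in_setU in_setI negb_or zl andbT (negPf zX). Qed.

(** Nonloops of [F] on the left of [z] yield a prefix and those on the right a suffix; the loops
    replace a missing side. When both sides occur, [corner_gap] makes the union flat. *)
Lemma cyclic_flat_separation (F : {set 'I_n}) (z : 'I_n) :
  F \in cyclic_flats M -> z \notin F ->
  exists A B, [/\ A \in prefix_flats, B \in suffix_flats,
    A :|: B \in cyclic_flats M, F \subset A :|: B & z \notin A :|: B].
Proof.
move=> zF zn; have [lF hF] := cyclic_flat_bounds zF.
have zl : z \notin loops M by apply: contra zn; apply/subsetP.
have mlA : loops M \in prefix_flats by rewrite !inE eqxx.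
have mlB : loops M \in suffix_flats by rewrite !inE eqxx.
have neqz y : y \in F -> (y < z) || (z < y).
  move=> yF; rewrite -neq_ltn; apply: contra zn => /eqP/val_inj e.
  by rewrite -e.
have [/existsP[x /and3P[xF xl ltxz]]|nox] :=
    boolP [exists x, [&& x \in F, x \notin loops M & x < z]].
  have [a [s [I [[ca leaz lesa] aF sI iI eI]]]] := left_corner zF zn xF xl ltxz.
  have mA := mem_prefix_flats ca.
  have zA : z \notin core M (seg n 0 a).
    by apply: notin_core; rewrite ?mem_seg // -leqNgt.
  have [/existsP[y /and3P[yF yl ltzy]]|noy] :=
      boolP [exists y, [&& y \in F, y \notin loops M & z < y]].
    have [p [t [J [[cp ltzp lept] pF sJ iJ eJ]]]] := right_corner zF zn yF yl ltzy.
    have mB := mem_suffix_flats cp.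
    have zB : z \notin core M (seg n p n).
      by apply: notin_core; rewrite ?mem_seg // negb_and -ltnNge ltzp.
    have lt : hi a < lo p.
      by apply: (corner_gap zF zn ca cp _ lesa lept sI iI eI sJ iJ eJ); rewrite leaz.
    exists (core M (seg n 0 a)), (core M (seg n p n)); split=> //.
    - by rewrite in_cyclic_flats cyclicU ?prefix_cyclic ?suffix_cyclic
        ?prefix_suffix_flat.
    - rewrite -coreU; apply: (sub_core zF) => w wF wl.
      rewrite in_setU !mem_seg ltn_ord andbT.
      by case/orP: (neqz w wF) => [/(aF w wF wl) -> //|/(pF w wF wl) ->]; rewrite orbT.
    - by rewrite in_setU negb_or zA.
  exists (core M (seg n 0 a)), (loops M); rewrite (setUidPl _); last first.
    by case: (cyclic_flat_bounds (subsetP prefix_cyclic_flats _ mA)).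
  split=> //; first exact: (subsetP prefix_cyclic_flats).
  apply: (sub_core zF) => w wF wl; rewrite mem_seg /=; apply: aF => //.
  case/orP: (neqz w wF) => // ltzw; case/existsP: noy; exists w.
  by rewrite wF wl.
have F_right w : w \in F -> w \notin loops M -> z < w.
  move=> wF wl; case/orP: (neqz w wF) => // ltwz; case/existsP: nox; exists w.
  by rewrite wF wl.
have [/existsP[y /andP[yF yl]]|noy] :=
    boolP [exists y, (y \in F) && (y \notin loops M)].
  have [p [t [J [[cp ltzp _] pF _ _ _]]]] := right_corner zF zn yF yl (F_right y yF yl).
  have mB := mem_suffix_flats cp.
  exists (loops M), (core M (seg n p n)); rewrite (setUidPr _); last first.
    by case: (cyclic_flat_bounds (subsetP suffix_cyclic_flats _ mB)).
  split=> //; first exact: (subsetP suffix_cyclic_flats).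
    apply: (sub_core zF) => w wF wl; rewrite mem_seg ltn_ord andbT.
    by apply: pF => //; apply: F_right.
  by apply: notin_core; rewrite ?mem_seg // negb_and -ltnNge ltzp.
exists (loops M), (loops M); rewrite setUid; split=> //.
  exact: loops_cyclic_flat.
apply/subsetP => w wF; apply: contraR noy => wl; apply/existsP; exists w.
by rewrite wF.
Qed.

Lemma band_configuration_unique : configuration_unique M.
Proof.
move=> U N [eTU [Phi [Phi_im Phi_inj Phi_mono Phi_card Phi_rank]]].
apply: (isomorphic_of_chains Phi_im Phi_mono Phi_card Phi_rank eTU
  prefix_cyclic_flats suffix_cyclic_flats prefix_flats_chain suffix_flats_chain
  prefix_suffix_modular prefix_suffix_cover cyclic_flat_separation).
Qed.

End Band.

(** * Lattice path matroids *)

Definition height (w : seq step) (k : nat) : nat := count_mem North (take k w).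

Lemma height0 w : height w 0 = 0.
Proof. by rewrite /height take0. Qed.

Lemma height_size w k : size w <= k -> height w k = count_mem North w.
Proof. by move=> le; rewrite /height take_oversize. Qed.

Lemma height_le w k : height w k <= count_mem North w.
Proof. by rewrite -{2}(cat_take_drop k w) count_cat leq_addr. Qed.

Lemma letter_rcons w a k :
  k <= size w -> letter (rcons w a) k = letter w k.
Proof.
by case: k => // k ltk; rewrite /letter -cats1 onth_cat ltk.
Qed.

Lemma letter_size w a : letter (rcons w a) (size w).+1 = Some a.
Proof. by rewrite /letter -cats1 onth_cat ltnn subnn. Qed.

Lemma heightS w k : height w k.+1 = height w k + (letter w k.+1 == Some North).
Proof.
rewrite /height /letter; elim: w k => [|a w IHw] [|k] //=.
  by rewrite take0 addn0.
by rewrite IHw addnA.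
Qed.

Lemma height_unit_steps w : unit_steps (height w).
Proof.
move=> k; rewrite heightS; case: (_ == _);
  by rewrite ?addn0 ?addn1 ?leqnn ?leqnSn.
Qed.

Lemma letter_some w k : 0 < k <= size w -> exists a, letter w k = Some a.
Proof.
case: k => //= k; elim: w k => // a w IHw [|k] /=; first by exists a.
exact: IHw.
Qed.

Lemma height_north w k : height w k.+1 = (height w k).+1 -> letter w k.+1 = Some North.
Proof. by rewrite heightS; case: eqP => // _; lia. Qed.

Lemma height_east w k :
  k < size w -> height w k.+1 = height w k -> letter w k.+1 = Some East.
Proof.
move=> ltk; rewrite heightS; have [|a ->] := @letter_some w k.+1; first by [].
by case: a => //=; lia.
Qed.

Lemma north_positions_rcons w a :
  north_positions (rcons w a) =
    north_positions w ++ if a == North then [:: (size w).+1] else [::].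
Proof.
have e : iota 1 (size w).+1 = iota 1 (size w) ++ [:: (size w).+1].
  by rewrite -[in LHS](addn1 (size w)) iotaD add1n.
rewrite /north_positions size_rcons e filter_cat; congr (_ ++ _).
  apply: eq_in_filter => k; rewrite mem_iota => /andP[_ lek].
  by rewrite letter_rcons.
by rewrite (lock letter) /= -lock letter_size; case: a.
Qed.

Lemma size_north_positions w : size (north_positions w) = count_mem North w.
Proof.
elim/last_ind: w => // w a IHw; rewrite north_positions_rcons size_cat IHw.
by rewrite -cats1 count_cat /=; case: a.
Qed.

(** Dictionary between positions and heights: indices of north steps start at 0 while positions
    start at 1, so [i < height w k] says that the step of index [i] is among the first [k]. *)
Lemma nth_north_positions w i k : i < count_mem North w ->
  (nth 0 (north_positions w) i <= k) = (i < height w k).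
Proof.
elim/last_ind: w => // w a IHw; rewrite -{1}cats1 count_cat /= addn0 => lti.
have hr : height (rcons w a) k =
    if k <= size w then height w k else count_mem North w + (a == North).
  rewrite /height -cats1 take_cat; case: ltngtP => [//|ltk|->].
    rewrite take_oversize; last by rewrite /= subn_gt0.
    by rewrite count_cat /= addn0.
  by rewrite subnn take0 cats0 take_size.
rewrite north_positions_rcons nth_cat size_north_positions hr.
have [ltiw|leiw] := ltnP i (count_mem North w).
  rewrite IHw //; case: (leqP k (size w)) => // /ltnW lek.
  by rewrite height_size // ltiw ltn_addr.
case: a lti {hr} => /=; last by rewrite addn0 ltnNge leiw.
rewrite addn1 ltnS => lei.
have -> : i = count_mem North w by apply/eqP; rewrite eqn_leq lei.
rewrite subnn /=; case: (leqP k (size w)) => lek /=.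
  by rewrite [RHS]ltnNge height_le.
by rewrite ltnSn.
Qed.

(** * Independence in a lattice path matroid *)

Section LatticePath.

Variables (n : nat) (P Q : n.-tuple step).
Hypothesis same_end : endpoint P = endpoint Q.
Hypothesis P_below_Q : never_above P Q.

Notation lo := (height P).
Notation hi := (height Q).
Notation M := (lattice_path_matroid P Q).

Lemma lo_le_hi_height k : lo k <= hi k.
Proof. exact: P_below_Q. Qed.

Lemma height_endQ : hi n = count_mem North P.
Proof. by rewrite height_size ?size_tuple //; case: same_end. Qed.

Lemma height_end : lo n = hi n.
Proof. by rewrite height_endQ height_size ?size_tuple. Qed.

Lemma mem_path_sets (x : 'I_n) (i : 'I_(count_mem North P)) :
  (x \in path_sets n Q i) = (lo x <= i < hi x.+1).
Proof.
have ltiQ : i < count_mem North Q by case: same_end => _ <-.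
rewrite inE andbC nth_north_positions // (ltnNge x) nth_north_positions //.
by rewrite -leqNgt.
Qed.

(** Elements between [s] and [t] can only be matched to indices from [lo s] up to [hi t], exclusive,
    which gives necessity. Sufficiency is an explicit greedy matching. *)
Lemma lattice_path_indepP (X : {set 'I_n}) :
  reflect (forall s t, s <= t <= n -> cnt X s t + lo s <= hi t) (indep M X).
Proof.
have lo_mono := unit_steps_le (height_unit_steps P).
have hi_mono := unit_steps_le (height_unit_steps Q).
apply: (iffP existsP) => [[f /matchesP[injf fA]] s t /andP[lest letn]|crit].
  have letr : hi t <= count_mem North P.
    by rewrite -height_endQ; have := hi_mono _ _ letn; lia.
  have sub : f @: (X :&: seg n s t) \subset
      Some @: seg (count_mem North P) (lo s) (hi t).
    apply/subsetP => y /imsetP[x /setIP[xX]]; rewrite mem_seg => lex ->.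
    have [j fx] := fA _ xX; rewrite fx mem_path_sets => lej; apply: imset_f.
    rewrite mem_seg; have := lo_mono s x; have := hi_mono x.+1 t.
    by move: lex lej; clear; lia.
  have := subset_leq_card sub; rewrite card_in_imset; last first.
    by move=> x y /setIP[xX _] /setIP[yX _]; apply: injf.
  rewrite card_imset; last by move=> x y [].
  rewrite card_seg // -/(cnt X s t).
  have := lo_mono _ _ lest; have := lo_le_hi_height t; clear; lia.
(* For [x] in [X], the closed form of the greedy choice: the least index that is at least [lo x] and
   exceeds the indices of all earlier elements of [X]. The criterion for intervals ending at [x.+1]
   keeps it below [hi x.+1]. *)
pose g x := \max_(s < x.+1) (lo s + cnt X s x).
have g_lo x : lo x <= g x.
  have := @leq_bigmax _ (fun s : 'I_x.+1 => lo s + cnt X s x) ord_max.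
  by rewrite -/(g x) /= => /(leq_trans (leq_addr _ _)).
have g_max x : exists2 s, s <= x & g x = lo s + cnt X s x.
  have [|s es] := @eq_bigmax _ (fun s : 'I_x.+1 => lo s + cnt X s x).
    by rewrite card_ord.
  by exists s; rewrite // -ltnS.
have cntX (x : 'I_n) s : x \in X -> s <= x -> cnt X s x.+1 = (cnt X s x).+1.
  move=> xX lesx; rewrite (@cnt_cat _ _ s x) ?lesx ?leqnSn //.
  by rewrite cnt_in // addn1.
have g_hi (x : 'I_n) : x \in X -> g x < hi x.+1.
  move=> xX; have [s lesx ->] := g_max x.
  have := crit s x.+1; rewrite ltn_ord (leqW lesx) cntX // => /(_ isT).
  by clear; lia.
have g_mono (x y : 'I_n) : x \in X -> x < y -> g x < g y.
  move=> xX ltxy; have [s lesx ->] := g_max x.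
  have lts : s < y.+1 by rewrite ltnS (leq_trans lesx) // ltnW.
  have := @leq_bigmax _ (fun s : 'I_y.+1 => lo s + cnt X s y) (Ordinal lts).
  rewrite -/(g y) /=; have := @cnt_wide _ X s s x.+1 y (leqnn s) ltxy.
  by rewrite cntX //; clear; lia.
have g_r (x : 'I_n) : x \in X -> g x < count_mem North P.
  move=> xX; apply: leq_trans (g_hi x xX) _; rewrite -height_endQ.
  by have := hi_mono _ _ (ltn_ord x); lia.
exists [ffun x : 'I_n => insub (g x)]; apply/matchesP; split=> [x y xX yX|x xX].
  rewrite !ffunE (insubT (fun k => k < count_mem North P) (g_r x xX)).
  rewrite (insubT (fun k => k < count_mem North P) (g_r y yX)).
  case=> e; apply/val_inj; case: (ltngtP x y) => // lt.
    by have := g_mono x y xX lt; rewrite e ltnn.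
  by have := g_mono y x yX lt; rewrite e ltnn.
exists (Ordinal (g_r x xX)); last by rewrite mem_path_sets /= g_lo g_hi.
by rewrite ffunE (insubT (fun k => k < count_mem North P) (g_r x xX)).
Qed.

Lemma common_pointE k : common_point P Q k = (k <= n) && (lo k == hi k).
Proof.
rewrite /common_point size_tuple; case: leqP => //= lekn.
have sz (w : n.-tuple step) :
    count_mem East (take k w) + count_mem North (take k w) = k.
  have e : size (take k w) = k by rewrite size_takel ?size_tuple.
  rewrite -[RHS]e -(count_predC (pred1 East) (take k w)).
  by congr (_ + _); apply: eq_count; case.
have := sz P; have := sz Q; rewrite /endpoint xpair_eqE /height.
by move=> e1 e2; case: eqP => [e|ne]; case: eqP; lia.
Qed.

Lemma letter_portion (w : seq step) c d k :
  0 < k <= d - c -> letter (portion w c d) k = letter w (c + k).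
Proof.
case: k => // k /= ltk; rewrite addnS /= /portion !onthE.
rewrite map_take map_drop nth_take // nth_drop //.
Qed.

Lemma rank_restr (X : {set 'I_n}) (A : {set {x : 'I_n | x \in X}}) :
  rank (restr M X) A = rank M (val @: A).
Proof.
apply/eqP; rewrite eqn_leq; apply/andP; split.
  have [I [iI sI <-]] := rank_basis (restr M X) A.
  rewrite -(card_imset _ val_inj); apply: rank_ge => //; exact: imsetS.
have [I [iI sI <-]] := rank_basis M (val @: A).
have eI : val @: (val @^-1: I : {set {x : 'I_n | x \in X}}) = I.
  apply/setP => x; apply/imsetP/idP => [[y + ->]|xI]; first by rewrite inE.
  have /imsetP[y yA e] := subsetP sI _ xI; exists y => //.
  by rewrite inE -e.
rewrite -{1}eI (card_imset _ val_inj); apply: rank_ge.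
  by rewrite /= /restr_indep eI.
apply/subsetP => y; rewrite inE => /(subsetP sI)/imsetP[z zA /val_inj ->] //.
Qed.

(** * From modular pairs to comparable corners *)

Hypothesis modular : forall X : {set 'I_n},
  connected_component M X -> forall A B : {set {x : 'I_n | x \in X}},
  initial_connected_flat P Q A -> final_connected_flat P Q B ->
  modular_pair (restr M X) A B.

Lemma interval_seg a b : interval n a.+1 b = seg n a b.
Proof. by apply/setP => x; rewrite !inE. Qed.

Lemma corners_comparable_in_segment c d a p :
  consecutive_common_points P Q c d -> c < a < d -> c < p < d ->
  hi_corner n hi a -> lo_corner n lo p -> hi a <= lo p + (a - p).
Proof.
move=> cons; have [ltcd cc cd nocom] := cons.
move: cc cd; rewrite !common_pointE => /andP[lecn /eqP ec] /andP[ledn /eqP ed].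
move=> /andP[ltca ltad] /andP[ltcp ltpd].
case/and4P => a0 ltan /eqP ea /eqP ea'; case/and4P => p0 ltpn /eqP ep /eqP ep'.
have comp : connected_component M (seg n c d).
  apply: (common_segment_component (height0 P) (height0 Q) height_end lo_le_hi_height
    (height_unit_steps P) (height_unit_steps Q) lattice_path_indepP _ ec ed).
  - by rewrite ledn andbT (leq_ltn_trans ltca).
  move=> k lek; have := nocom k lek; rewrite common_pointE.
  have := lo_le_hi_height k; rewrite leq_eqVlt => /orP[->|//].
  by rewrite (leq_trans _ ledn) // ltnW //; case/andP: lek.
pose A := [set x : {x : 'I_n | x \in seg n c d} | val x \in seg n c a].
pose B := [set x : {x : 'I_n | x \in seg n c d} | val x \in seg n p d].
have vE (Y : {set 'I_n}) : Y \subset seg n c d ->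
    val @: [set x : {x : 'I_n | x \in seg n c d} | val x \in Y] = Y.
  move=> sY; apply/setP => x; apply/imsetP/idP => [[y + ->]|xY]; first by rewrite inE.
  by exists (Sub x (subsetP sY x xY)); rewrite ?inE SubK.
have vA : val @: A = seg n c a.
  by apply: vE; apply/subsetP => x; rewrite !mem_seg => /andP[-> /ltn_trans]; apply.
have vB : val @: B = seg n p d.
  apply: vE; apply/subsetP => x; rewrite !mem_seg => /andP[lepx ->].
  by rewrite andbT (leq_trans (ltnW ltcp)).
have fA : initial_connected_flat P Q A.
  exists c, d, (a - c); split=> //.
  - rewrite letter_portion; last by clear -ltca ltad; lia.
    have -> : c + (a - c) = a.-1.+1 by clear -ltca; lia.
    by apply: height_east; rewrite ?size_tuple ?prednK // ltnW.
  - rewrite letter_portion; last by clear -ltca ltad; lia.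
    have -> : c + (a - c).+1 = a.+1 by clear -ltca; lia.
    exact: height_north.
  - have -> : c + (a - c) = a by clear -ltca; lia.
    by rewrite vA interval_seg.
have fB : final_connected_flat P Q B.
  (* The corner is reached after [p] steps, so the final flat begins with the next step, the east
     step at position [p - c + 1] of the portion. *)
  exists c, d, (p - c).+1; split=> //.
  - rewrite letter_portion; last by clear -ltcp ltpd; lia.
    have -> : c + (p - c) = p.-1.+1 by clear -ltcp; lia.
    by apply: height_north; rewrite prednK.
  - rewrite letter_portion; last by clear -ltcp ltpd; lia.
    have -> : c + (p - c).+1 = p.+1 by clear -ltcp; lia.
    by apply: height_east; rewrite ?size_tuple.
  - have -> : c + (p - c).+1 = p.+1 by clear -ltcp; lia.
    by rewrite vB interval_seg.
have := modular comp fA fB; rewrite /modular_pair !rank_restr imsetU imsetI.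
  rewrite vA vB => e.
  apply: (segments_modular_bound (height0 P) (height0 Q) height_end lo_le_hi_height
    (height_unit_steps P) (height_unit_steps Q) lattice_path_indepP _ _ ledn ec ed).
  - by rewrite (ltnW ltca) (ltnW ltad).
  - by rewrite (ltnW ltcp) (ltnW ltpd).
  - by rewrite e.
by move=> x y _ _; apply: val_inj.
Qed.

(** If a common point [k] lies weakly between [a] and [p], the bound follows by going through
    [hi k = lo k], as each path rises by at most one per step. Otherwise both corners lie strictly
    between the same two consecutive common points, where modularity applies. *)
Lemma corners_comparable_height a p :
  hi_corner n hi a -> lo_corner n lo p -> hi a <= lo p + (a - p).
Proof.
move=> ca cp; have /and4P[a0 ltan _ _] := ca; have /and4P[p0 ltpn _ _] := cp.
have lo_mono := unit_steps_le (height_unit_steps P).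
have hi_mono := unit_steps_le (height_unit_steps Q).
pose C k := (k <= n) && (lo k == hi k).
have [/existsP[k /andP[/andP[lemk lekM] /eqP ek]]|nok] := boolP
    [exists k : 'I_n.+1, (minn a p <= k <= maxn a p) && (lo k == hi k)].
  have := lo_mono k p; have := lo_mono p k; have := hi_mono a k.
  by have := hi_mono k a; clear -lemk lekM ek; lia.
have noC k : minn a p <= k <= maxn a p -> ~~ C k.
  move=> lek; apply: contra nok => /andP[lekn ck].
  by apply/existsP; exists (Ordinal (lekn : k < n.+1)); rewrite lek.
have exc : exists k, (k <= minn a p) && C k.
  by exists 0; rewrite /C !height0 eqxx.
have bc k : (k <= minn a p) && C k -> k <= minn a p by case/andP.
have exd : exists k, (maxn a p <= k) && C k.
  by exists n; rewrite /C leqnn height_end eqxx andbT geq_max (ltnW ltan) ltnW.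
case: (ex_maxnP exc bc) => c /andP[lec Cc] maxc.
case: (ex_minnP exd) => d /andP[led Cd] mind.
have ltc : c < minn a p.
  rewrite ltn_neqAle lec andbT; apply: contraTN Cc => /eqP ->; apply: noC.
  by clear; lia.
have ltd : maxn a p < d.
  rewrite ltn_neqAle led andbT; apply: contraTN Cd => /eqP <-; apply: noC.
  by clear; lia.
apply: (@corners_comparable_in_segment c d) => //; try by clear -ltc ltd; lia.
split; rewrite ?common_pointE //; first by clear -ltc ltd; lia.
move=> k /andP[ltck ltkd]; rewrite common_pointE -/(C k).
have [lekm|ltmk] := leqP k (minn a p).
  apply/negP => Ck; have := maxc k; rewrite lekm Ck => /(_ isT).
  by rewrite leqNgt ltck.
have [ltkM|leMk] := leqP k (maxn a p); first by apply: noC; rewrite ltkM ltnW.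
apply/negP => Ck; have := mind k; rewrite (ltnW leMk) Ck => /(_ isT).
by rewrite leqNgt ltkd.
Qed.

End LatticePath.

Theorem theorem4p5 (n : nat) (P Q : n.-tuple step)
    (same_end : endpoint P = endpoint Q)
    (P_below_Q : never_above P Q)
    (modular : forall X : {set 'I_n},
       connected_component (lattice_path_matroid P Q) X ->
       forall A B : {set {x : 'I_n | x \in X}},
       initial_connected_flat P Q A ->
       final_connected_flat P Q B ->
       modular_pair (restr (lattice_path_matroid P Q) X) A B) :
  configuration_unique (lattice_path_matroid P Q).
Proof.
apply: (@band_configuration_unique _ _ (height P) (height Q)) => //.
- exact: height0.
- exact: height0.
- exact: height_end.
- exact: height_unit_steps.
- exact: height_unit_steps.
- exact: lattice_path_indepP.
- exact: corners_comparable_height.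
Qed.
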